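(* Let $\mu\in\mathcal{M}_{\mathrm{loc},\mathrm{unif}}(\mathbb{R})$ be a weak Gordon measure with weight $C$ for all $C>0$. Then $H_\mu$ does not have any eigenvalues.
   Context: A local measure on $\mathbb{R}$ is a map $\mu$ from the bounded Borel subsets of $\mathbb{R}$ to $\mathbb{C}$ such that $\mathbf{1}_K\mu:=\mu(\cdot\cap K)$ is a complex Radon measure for every compact $K\subseteq\mathbb{R}$; $|\mu|$ denotes its total variation (a nonnegative Radon measure on $\mathbb{R}$). Put $\|\mu\|_{\mathrm{unif}}:=\sup_{a\in\mathbb{R}}|\mu|((a,a+1])$, and let $\mathcal{M}_{\mathrm{loc},\mathrm{unif}}(\mathbb{R})$ be the space of all local measures $\mu$ with $\|\mu\|_{\mathrm{unif}}<\infty$. Let $W^1_\infty(\mathbb{R})$ denote the (complex-valued) Lipschitz continuous functions on $\mathbb{R}$. For $\mu\in\mathcal{M}_{\mathrm{loc},\mathrm{unif}}(\mathbb{R})$ and $I\subseteq\mathbb{R}$ define $$\|\mu\|_I:=\sup\Bigl\{\Bigl|\int u\,d\mu\Bigr| : u\in W^1_\infty(\mathbb{R}),\ \operatorname{spt}u\subseteq I,\ \operatorname{diam}\operatorname{spt}u\le 2,\ \|u'\|_\infty\le 1\Bigr\}.$$ For $p\in\mathbb{R}$, $\mu(\cdot+p)$ denotes the translate $B\mapsto\mu(B+p)$. For $C>0$, $\mu$ is called a weak Gordon measure with weight $C$ if there is a sequence $(p_m)$ in $(0,\infty)$ (which may depend on $C$) with $p_m\to\infty$ and $\lim_{m\to\infty}e^{Cp_m}\|\mu-\mu(\cdot+p_m)\|_{[-p_m,p_m]}=0$.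 The operator $H_\mu$ in $L_2(\mathbb{R})$ is defined by $D(H_\mu):=\{u\in L_2(\mathbb{R})\cap C(\mathbb{R}) : -u''+u\mu\in L_2(\mathbb{R})\}$, $H_\mu u:=-u''+u\mu$, in the sense of distributions; i.e. for $u,f\in L_2(\mathbb{R})$, one has $u\in D(H_\mu)$ and $H_\mu u=f$ iff $u$ is continuous and $\int_{\mathbb{R}}f\varphi=-\int_{\mathbb{R}}u\varphi''+\int_{\mathbb{R}}u\varphi\,d\mu$ for all $\varphi\in C_c^\infty(\mathbb{R})$. *)

(* Defs.v *)
From HB Require Import structures.
From mathcomp Require Import all_boot all_order all_algebra.
From mathcomp Require Import all_classical all_reals all_analysis.
From mathcomp Require Import measurable_realfun.
From mathcomp Require Import complex.

Set Implicit Arguments.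
Unset Strict Implicit.
Unset Printing Implicit Defensive.

Import Order.TTheory GRing.Theory Num.Theory.
Import numFieldNormedType.Exports.

Local Open Scope classical_set_scope.
Local Open Scope ring_scope.
Local Open Scope complex_scope.

Section complex_valued_functions.
Context {R : realType}.
Implicit Types u phi : R -> R[i].

(* [R[i]] carries no canonical topology, measurable structure or normed
   [R]-module structure, so that limits, continuity, derivatives and integrals
   of complex-valued functions are taken on the real and imaginary parts. *)
Definition re_part u : R -> R := fun x => complex.Re (u x).
Definition im_part u : R -> R := fun x => complex.Im (u x).

(* the modulus, as an element of [R] rather than of [R[i]] *)
Definition cmod (z : R[i]) : R := Normc.normc z.

Definition ccvg (z : nat -> R[i]) (l : R[i]) : Prop :=
  (fun n => complex.Re (z n)) @ \oo --> complex.Re l /\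
  (fun n => complex.Im (z n)) @ \oo --> complex.Im l.

Definition ccontinuous u : Prop :=
  continuous (re_part u) /\ continuous (im_part u).

Definition clipschitz u : Prop :=
  exists k : R, forall x y, cmod (u x - u y) <= k * `|x - y|.

Definition cderivable u (x : R) : Prop :=
  derivable (re_part u) x 1 /\ derivable (im_part u) x 1.

Definition cderive1n (n : nat) u : R -> R[i] :=
  fun x => derive1n n (re_part u) x +i* derive1n n (im_part u) x.

Definition csmooth u : Prop :=
  forall (n : nat) (x : R), cderivable (cderive1n n u) x.

Definition spt u : set R := closure [set x | u x != 0].

(* [C_c^infty] *)
Definition test_function phi : Prop := csmooth phi /\ compact (spt phi).

(* A Lipschitz function is differentiable only almost everywhere; its
   derivative is extended by 0 to the remaining null set. *)
Definition norm_derive u (x : R) : R :=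
  if `[< cderivable u x >] then cmod (cderive1n 1 u x) else 0.

Definition sup_norm_derive u : \bar R :=
  Lnorm (@lebesgue_measure R) +oo%E (fun x => (norm_derive u x)%:E).

Definition cLintegral u : R[i] :=
  (\int[@lebesgue_measure R]_x re_part u x) +i*
  (\int[@lebesgue_measure R]_x im_part u x).

Definition cL2 u : Prop :=
  [/\ measurable_fun setT (re_part u), measurable_fun setT (im_part u) &
      (Lnorm (@lebesgue_measure R) 2%:E (fun x => (cmod (u x))%:E) < +oo)%E].

End complex_valued_functions.

(* Only the values on bounded Borel sets are meaningful.  A complex Borel
   measure on the real line is automatically Radon, so the requirement on
   [B |-> mu (B `&` K)] is countable additivity; taking all [F n] empty gives
   [mu set0 = 0]. *)
Record localMeasure (R : realType) := LocalMeasure {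
  local_measure :> set R -> R[i] ;
  local_measure_sigma_additive : forall K : set R, compact K ->
    forall F : nat -> set R, (forall n, measurable (F n)) -> trivIset setT F ->
    ccvg (fun n => \sum_(0 <= i < n) local_measure (F i `&` K))
         (local_measure ((\bigcup_n F n) `&` K))
}.

Section operations.
Context {R : realType}.
Implicit Types mu nu : localMeasure R.

Lemma ccvgB (y z : nat -> R[i]) (k l : R[i]) :
  ccvg y k -> ccvg z l -> ccvg (fun n => y n - z n) (k - l).
Proof.
move=> [yr yi] [zr zi]; split.
- rewrite raddfB /=.
  under eq_fun do rewrite raddfB /=.
  exact: cvgB.
- rewrite raddfB /=.
  under eq_fun do rewrite raddfB /=.
  exact: cvgB.
Qed.

Lemma local_sub_sigma_additive mu nu (K : set R) : compact K ->
  forall F : nat -> set R, (forall n, measurable (F n)) -> trivIset setT F ->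
  ccvg (fun n => \sum_(0 <= i < n) (mu (F i `&` K) - nu (F i `&` K)))
       (mu ((\bigcup_n F n) `&` K) - nu ((\bigcup_n F n) `&` K)).
Proof.
move=> cK F mF tF; under eq_fun do rewrite sumrB.
by apply: ccvgB; apply: local_measure_sigma_additive.
Qed.

Definition local_sub mu nu : localMeasure R :=
  @LocalMeasure R (fun B => mu B - nu B) (local_sub_sigma_additive mu nu).

Definition shift_set (p : R) (B : set R) : set R := [set x + p | x in B].

Lemma shift_setE p B : shift_set p B = (fun x => x - p) @^-1` B.
Proof.
apply/seteqP; split => [_ [x Bx <-]|x Bx] /=; first by rewrite addrK.
by exists (x - p) => //; rewrite subrK.
Qed.

Lemma local_translate_sigma_additive mu p (K : set R) : compact K ->
  forall F : nat -> set R, (forall n, measurable (F n)) -> trivIset setT F ->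
  ccvg (fun n => \sum_(0 <= i < n) mu (shift_set p (F i `&` K)))
       (mu (shift_set p ((\bigcup_n F n) `&` K))).
Proof.
move=> cK F mF tF.
have cvp : continuous (fun x : R => x + p).
  by move=> x; apply: cvgD; [exact: cvg_id|exact: cvg_cst].
have cK' : compact (shift_set p K).
  by apply: continuous_compact => //; apply: continuous_subspaceT.
have sI A B : shift_set p (A `&` B) = shift_set p A `&` shift_set p B.
  by rewrite !shift_setE preimage_setI.
under eq_fun do under eq_bigr do rewrite sI.
rewrite sI (_ : shift_set p (\bigcup_n F n) = \bigcup_n shift_set p (F n)).
  apply: local_measure_sigma_additive => //.
  - move=> n; rewrite shift_setE -[_ @^-1` _]setTI.
    have mB : measurable_fun setT (fun x : R => x - p).
      by apply: measurable_funB; [exact: measurable_id|exact: measurable_cst].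
    exact: mB.
  - apply/trivIsetP => i j _ _ ij; rewrite -sI.
    by move/trivIsetP : tF => ->//; rewrite shift_setE preimage_set0.
rewrite shift_setE preimage_bigcup.
by apply: eq_bigcup => // i _; rewrite shift_setE.
Qed.

(* [mu (. + p)] *)
Definition local_translate (p : R) mu : localMeasure R :=
  @LocalMeasure R (fun B => mu (shift_set p B))
    (local_translate_sigma_additive mu p).

End operations.

Section restriction.
Context {R : realType}.
Implicit Type mu : localMeasure R.

Lemma cvg_mulrn_eq0 (r : R) : (fun n => r *+ n) @ \oo --> r -> r = 0.
Proof.
move=> h.
have h1 : (fun n => r *+ n.+1) @ \oo --> r.
  by have := h; rewrite -(@cvg_shiftS _ (fun n => r *+ n)).
have : (fun n => r *+ n.+1 - r *+ n) @ \oo --> r - r by exact: cvgB.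
rewrite subrr.
under eq_fun do rewrite mulrSr addrAC subrr add0r.
by move=> /cvg_lim <- //; rewrite lim_cst.
Qed.

Lemma local_measure0 mu : mu set0 = 0.
Proof.
have [] := @local_measure_sigma_additive _ mu set0 (@compact0 _) (fun=> set0)
  (fun=> measurable0) (@trivIset_set0 _ _ setT).
rewrite bigcup0 // setI0.
under eq_fun do rewrite sumr_const_nat subn0 raddfMn.
move=> /= /cvg_mulrn_eq0 rh.
under eq_fun do rewrite sumr_const_nat subn0 raddfMn.
move=> /= /cvg_mulrn_eq0 ih.
by apply/eqP; rewrite eq_complex rh ih !eqxx.
Qed.

(* Real and imaginary parts of [1_K mu], which are charges since [K] is
   compact. *)
Definition re_restr mu (K : set R) (_ : compact K) :
    set (measurableTypeR R) -> \bar R :=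
  fun B => (complex.Re (mu (B `&` K)))%:E.
Definition im_restr mu (K : set R) (_ : compact K) :
    set (measurableTypeR R) -> \bar R :=
  fun B => (complex.Im (mu (B `&` K)))%:E.

Variables (mu : localMeasure R) (K : set R) (cK : compact K).

Let re_restr0 : re_restr mu cK set0 = 0%E.
Proof. by rewrite /re_restr set0I local_measure0. Qed.

Let im_restr0 : im_restr mu cK set0 = 0%E.
Proof. by rewrite /im_restr set0I local_measure0. Qed.

Let re_restr_fin (B : set (measurableTypeR R)) :
  measurable B -> re_restr mu cK B \is a fin_num.
Proof. by []. Qed.

Let im_restr_fin (B : set (measurableTypeR R)) :
  measurable B -> im_restr mu cK B \is a fin_num.
Proof. by []. Qed.

Let re_restr_sigma_additive : semi_sigma_additive (re_restr mu cK).
Proof.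
move=> F mF tF _; have [h _] := local_measure_sigma_additive mu cK mF tF.
under eq_fun do rewrite sumEFin -raddf_sum.
by apply: cvg_EFin => //; exact: nearW.
Qed.

Let im_restr_sigma_additive : semi_sigma_additive (im_restr mu cK).
Proof.
move=> F mF tF _; have [_ h] := local_measure_sigma_additive mu cK mF tF.
under eq_fun do rewrite sumEFin -raddf_sum.
by apply: cvg_EFin => //; exact: nearW.
Qed.

HB.instance Definition _ := isCharge.Build _ _ _ (re_restr mu cK)
  re_restr0 re_restr_fin re_restr_sigma_additive.
HB.instance Definition _ := isCharge.Build _ _ _ (im_restr mu cK)
  im_restr0 im_restr_fin im_restr_sigma_additive.

End restriction.

Section integration.
Context {R : realType}.
Implicit Types (nu : {charge set (measurableTypeR R) -> \bar R}).
Implicit Types (mu : localMeasure R) (u phi f : R -> R[i]).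

(* A chosen Hahn decomposition; the Jordan decomposition, hence
   [charge_integral], does not depend on the choice. *)
Definition hahn_set nu : set R := projT1 (cid (Hahn_decomposition nu)).
Definition hahn_setC nu : set R :=
  projT1 (cid (projT2 (cid (Hahn_decomposition nu)))).
Definition hahn_setP nu : hahn_decomposition nu (hahn_set nu) (hahn_setC nu) :=
  projT2 (cid (projT2 (cid (Hahn_decomposition nu)))).

Definition charge_integral nu (g : R -> R) : R :=
  \int[jordan_pos (hahn_setP nu)]_x g x - \int[jordan_neg (hahn_setP nu)]_x g x.

Definition restr_integral mu (K : set R) (cK : compact K) u : R[i] :=
  (charge_integral (re_restr mu cK) (re_part u)
     - charge_integral (im_restr mu cK) (im_part u)) +i*
  (charge_integral (re_restr mu cK) (im_part u)
     + charge_integral (im_restr mu cK) (re_part u)).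

(* The integral of [u] against [mu], for compactly supported [u], is the
   integral against the complex measure [1_K mu] with [K := spt u]; the value 0
   in the other case is never used. *)
Definition local_integral mu u : R[i] :=
  if pselect (compact (spt u)) is left cK then restr_integral mu cK u else 0.

(* [|mu| B] for bounded Borel [B], by countable Borel partitions of [B] *)
Definition local_variation mu (B : set R) : \bar R :=
  ereal_sup [set s | exists F : nat -> set R,
    [/\ forall n, measurable (F n), trivIset setT F, \bigcup_n F n = B &
        s = (\sum_(0 <= n <oo) (cmod (mu (F n)))%:E)%E]].

Definition unif_norm mu : \bar R :=
  ereal_sup [set local_variation mu `]a, a + 1] | a in [set: R]].

Definition loc_unif mu : Prop := (unif_norm mu < +oo)%E.

(* [||mu||_I]; the third condition is [diam (spt u) <= 2] *)
Definition dual_lipschitz_norm mu (I : set R) : \bar R :=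
  ereal_sup [set (cmod (local_integral mu u))%:E | u in [set u |
    [/\ clipschitz u, spt u `<=` I,
        forall x y, spt u x -> spt u y -> `|x - y| <= 2 &
        (sup_norm_derive u <= 1)%E]]].

Definition weak_gordon (C : R) mu : Prop :=
  exists p : nat -> R, [/\ forall m, 0 < p m, p @ \oo --> +oo &
    ((expR (C * p m))%:E *
      dual_lipschitz_norm (local_sub mu (local_translate (p m) mu))
        `[(- p m)%R, p m])%E @[m --> \oo] --> 0%E].

(* [schrodinger mu u f] is the graph of [H_mu]: [u] is in the domain and
   [H_mu u = f].  Elements of [L_2] are represented by functions; the one in
   the domain by its continuous representative. *)
Definition schrodinger mu u f : Prop :=
  [/\ cL2 u, cL2 f, ccontinuous u &
    forall phi, test_function phi ->
      cLintegral (fun x => f x * phi x) =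
      - cLintegral (fun x => u x * cderive1n 2 phi x)
      + local_integral mu (fun x => u x * phi x)].

Definition schrodinger_eigenvalue mu (lambda : R[i]) : Prop :=
  exists u, schrodinger mu u (fun x => lambda * u x) /\
    ~ {ae @lebesgue_measure R, forall x, u x = 0}.

End integration.

(* Main.v *)
Require Import Defs.
From mathcomp Require Import all_boot all_order all_algebra.
From mathcomp Require Import all_classical all_reals all_analysis.
From mathcomp Require Import measurable_realfun ess_sup_inf.
From mathcomp Require Import complex.
From mathcomp Require Import ring lra.

Import Order.TTheory GRing.Theory Num.Theory.
Import numFieldNormedType.Exports.

Set Implicit Arguments.
Unset Strict Implicit.
Unset Printing Implicit Defensive.

Local Open Scope classical_set_scope.
Local Open Scope ring_scope.
Local Open Scope complex_scope.

(** Why there are no eigenvalues.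

    Let [u] be an eigenfunction for [lambda] and [nu = mu - lambda dx], so that
    formally [u'' = u nu]. Gordon's classical argument compares [u] with its
    translates [u (. + p)] and [u (. - p)]. If [nu] were [p]-periodic, all three
    would solve the same equation; the Wronskian of [u] and [u (. + p)] would be
    a constant, and its value at [x - p] would be that of [u (. - p)] and [u] at
    [x]. Hence [q = u (. + p) + u (. - p)] has Wronskian [0] with [u], that is,
    [q = tau * u] for a constant [tau]. Since an eigenfunction tends to [0] at
    infinity, [q x0] is small for large [p] and fixed [x0 >= 0], and so is
    [tau] if [u x0 <> 0]. At [p - z] with [z >= 0] the same relation says that
    [u (2 * p - z) + u (- z) = tau * u (p - z)], which for large [p] forces
    [u (- z) = 0]. So [u] vanishes on a half-line, and then everywhere.

    For a weak Gordon measure the translates solve the equation up to an error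
    [expR (- C * p)] for every [C], whereas the relation [q = tau * u] loses at
    most a factor [expR (Q * p)], with [Q] depending on [mu] and [lambda] alone,
    when it is carried from [x0] to [p - z]. The point that needs care is that
    closeness in the weak norm controls neither the derivatives of solutions nor
    their Wronskians pointwise. Derivatives are therefore avoided altogether:
    the equation is used in the form [three_point], the pairing of [nu] with a
    hat function times [u] equals a second difference of [u], which makes sense
    for translates and linear combinations ([approx_sol]) and is compatible with
    the weak norm because hat times solution is Lipschitz. Wronskians are
    replaced by finite differences on a grid of mesh [h] of size
    [expR (- C1 * p)] ([wronskian]): this costs an error of order [h] and divides
    the weak error by powers of [h], which is harmless since [C] may be taken
    much larger than [C1]. The propagation is a discrete Gronwall inequality
    ([gronwall]), and [one_period_estimate] collects the errors.

    The analytic input consists of three parts. Both integrals in the definition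
    of the operator are limits of Riemann sums over half-open intervals
    ([stieltjes_local], [stieltjes_leb]), from which linearity, the bound by the
    variation and the behaviour under translation are read off ([nu_lin],
    [nu_bound], [nu_gordon]). The three-point equation follows from the
    distributional one by mollifying the hat ([bump_dirac]). Finally, the
    three-point equation bounds differences of [u] on a unit interval by its
    supremum there, so that square integrability implies that [u] is bounded,
    Lipschitz and vanishes at infinity ([local_lipschitz],
    [vanish_at_infinity], [global_bounds]). *)

(** * Complex-valued functions *)

Section modulus.
Context {R : realType}.
Implicit Types (z w : R[i]).

Lemma cmod_ge0 z : 0 <= cmod z.
Proof. by case: z => a b; exact: sqrtr_ge0. Qed.

Lemma cmod0 : cmod (0 : R[i]) = 0.
Proof. exact: Normc.normc0. Qed.

Lemma cmod_eq0 z : cmod z = 0 -> z = 0.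
Proof. exact: Normc.eq0_normc. Qed.

Lemma cmodM z w : cmod (z * w) = cmod z * cmod w.
Proof. exact: Normc.normcM. Qed.

Lemma cmodV z : cmod z^-1 = (cmod z)^-1.
Proof. exact: Normc.normcV. Qed.

Lemma cmodN z : cmod (- z) = cmod z.
Proof. by case: z => a b; rewrite /cmod /= !sqrrN. Qed.

Lemma cmodD z w : cmod (z + w) <= cmod z + cmod w.
Proof. exact: le_normcD. Qed.

Lemma cmodB z w : cmod (z - w) <= cmod z + cmod w.
Proof. by rewrite -(cmodN w); exact: cmodD. Qed.

Lemma cmod_distC z w : cmod (z - w) = cmod (w - z).
Proof. by rewrite -cmodN opprB. Qed.

Lemma cmod_le_sub z w : cmod z <= cmod w + cmod (z - w).
Proof. by rewrite -[z in leLHS](subrKC w); exact: cmodD. Qed.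

Lemma cmodR (x : R) : cmod x%:C = `|x|.
Proof. by rewrite /cmod /= expr0n addr0 sqrtr_sqr. Qed.

Lemma cmodRM (x : R) z : 0 <= x -> cmod (x%:C * z) = x * cmod z.
Proof. by move=> x0; rewrite cmodM cmodR ger0_norm. Qed.

Lemma Re_le_cmod z : `|complex.Re z| <= cmod z.
Proof.
case: z => a b; rewrite /cmod /= -sqrtr_sqr ler_wsqrtr//.
by rewrite lerDl sqr_ge0.
Qed.

Lemma Im_le_cmod z : `|complex.Im z| <= cmod z.
Proof.
case: z => a b; rewrite /cmod /= -sqrtr_sqr ler_wsqrtr//.
by rewrite lerDr sqr_ge0.
Qed.

Lemma cmod_le_ReIm z : cmod z <= `|complex.Re z| + `|complex.Im z|.
Proof.
rewrite [z in leLHS]complexE (le_trans (cmodD _ _))// cmodM !cmodR.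
by rewrite {1}/cmod /= expr0n add0r expr1n sqrtr1 mul1r.
Qed.

Lemma cmod_sum (I : Type) (r : seq I) (P : pred I) (F : I -> R[i]) :
  cmod (\sum_(i <- r | P i) F i) <= \sum_(i <- r | P i) cmod (F i).
Proof.
elim/big_ind2 : _ => [|x1 x2 y1 y2 h1 h2|//]; first by rewrite cmod0.
by rewrite (le_trans (cmodD _ _))// lerD.
Qed.

Lemma cmod_le_eq0 z : (forall e, 0 < e -> cmod z <= e) -> z = 0.
Proof.
move=> h; apply/cmod_eq0/le_anti; rewrite cmod_ge0 andbT.
by apply/ler_addgt0Pr => e e0; rewrite add0r h.
Qed.

End modulus.

Section continuity.
Context {R : realType}.
Implicit Types (u v : R -> R[i]) (f : R -> R).

Lemma ccontinuous_cst (z : R[i]) : ccontinuous (fun _ : R => z).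
Proof. by split; exact: cst_continuous. Qed.

Lemma ccontinuousD u v : ccontinuous u -> ccontinuous v ->
  ccontinuous (fun x => u x + v x).
Proof.
move=> [ur ui] [vr vi]; split => x.
- rewrite (_ : re_part _ = re_part u \+ re_part v); last first.
    by apply/funext => y; rewrite /re_part raddfD.
  exact: (cvgD (ur x) (vr x)).
- rewrite (_ : im_part _ = im_part u \+ im_part v); last first.
    by apply/funext => y; rewrite /im_part raddfD.
  exact: (cvgD (ui x) (vi x)).
Qed.

Lemma ccontinuousM u v : ccontinuous u -> ccontinuous v ->
  ccontinuous (fun x => u x * v x).
Proof.
move=> [ur ui] [vr vi]; split => x.
- rewrite (_ : re_part _ = re_part u \* re_part v \- im_part u \* im_part v);
    last by apply/funext => y; rewrite /re_part /im_part /=; case: (u y); case: (v y).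
  exact: (cvgB (cvgM (ur x) (vr x)) (cvgM (ui x) (vi x))).
- rewrite (_ : im_part _ = re_part u \* im_part v \+ im_part u \* re_part v);
    last by apply/funext => y; rewrite /re_part /im_part /=; case: (u y); case: (v y).
  exact: (cvgD (cvgM (ur x) (vi x)) (cvgM (ui x) (vr x))).
Qed.

Lemma ccontinuousZ (z : R[i]) u : ccontinuous u -> ccontinuous (fun x => z * u x).
Proof. by apply: ccontinuousM; exact: ccontinuous_cst. Qed.

Lemma ccontinuousB u v : ccontinuous u -> ccontinuous v ->
  ccontinuous (fun x => u x - v x).
Proof.
move=> cu cv; rewrite (_ : (fun _ => _) = (fun x => u x + (-1) * v x)).
  by apply: ccontinuousD => //; exact: ccontinuousZ.
by apply/funext => x; rewrite mulN1r.
Qed.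

Lemma ccontinuousR f : continuous f -> ccontinuous (fun x => (f x)%:C).
Proof. by move=> cf; split => //; exact: cst_continuous. Qed.

Lemma ccontinuous_shift u p : ccontinuous u -> ccontinuous (fun x => u (x + p)).
Proof.
have cs : continuous (fun x : R => x + p).
  by move=> x; apply: cvgD; [exact: cvg_id|exact: cvg_cst].
by move=> [ur ui]; split => x; [exact: (continuous_comp (cs x) (ur _))|exact: (continuous_comp (cs x) (ui _))].
Qed.

Lemma ccontinuous_sum (I : Type) (r : seq I) (F : I -> R -> R[i]) :
  (forall i, ccontinuous (F i)) -> ccontinuous (fun x => \sum_(i <- r) F i x).
Proof.
move=> cF; elim: r => [|i r ih].
  under [fun _ => _]eq_fun do rewrite big_nil; exact: ccontinuous_cst.
by under [fun _ => _]eq_fun do rewrite big_cons; exact: ccontinuousD.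
Qed.

Lemma continuous_cmod u : ccontinuous u -> continuous (fun x => cmod (u x)).
Proof.
move=> [ur ui] x.
rewrite (_ : (fun _ => _) =
  Num.sqrt \o (re_part u \* re_part u \+ im_part u \* im_part u)); last first.
  by apply/funext => y; rewrite /cmod /re_part /im_part /=; case: (u y).
apply: continuous_comp; last exact: sqrt_continuous.
exact: (cvgD (cvgM (ur x) (ur x)) (cvgM (ui x) (ui x))).
Qed.

Lemma cmod_max u a b : ccontinuous u -> a <= b ->
  exists2 y, a <= y <= b & forall x, a <= x <= b -> cmod (u x) <= cmod (u y).
Proof.
move=> cu ab.
have := @EVT_max R (fun x => cmod (u x)) a b ab.
case=> [|y yab ymax]; first exact/continuous_subspaceT/continuous_cmod.
by exists y => [|x xab]; [rewrite in_itv /= in yab|apply: ymax; rewrite in_itv].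
Qed.

Lemma ccontinuous_near u (x e : R) : ccontinuous u -> 0 < e ->
  \forall y \near x, cmod (u y - u x) <= e.
Proof.
move=> cu e0.
have cd : ccontinuous (fun y => u y - u x).
  by apply: ccontinuousB => //; exact: ccontinuous_cst.
have /(_ x) := continuous_cmod cd; rewrite /continuous_at subrr cmod0.
move=> /cvgr0Pnorm_lt/(_ _ e0); apply: filterS => y.
by rewrite ger0_norm ?cmod_ge0// => /ltW.
Qed.

End continuity.

Section support.
Context {R : realType}.
Implicit Types (u v : R -> R[i]) (a b : R).

(** Stated pointwise instead of with the closed support, so that it passes
    through sums and products without topology. *)
Definition supp_in u a b := forall x, u x != 0 -> a <= x <= b.

Lemma supp_in_out u a b x : supp_in u a b -> ~~ (a <= x <= b) -> u x = 0.
Proof. by move=> su; apply: contraNeq => /su. Qed.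

Lemma supp_in_sub u a b a' b' : a' <= a -> b <= b' ->
  supp_in u a b -> supp_in u a' b'.
Proof. by move=> aa bb su x /su /andP[? ?]; apply/andP; split; lra. Qed.

Lemma supp_inM u v a b : supp_in u a b -> supp_in (fun x => u x * v x) a b.
Proof. by move=> su x; rewrite mulf_eq0 negb_or => /andP[/su]. Qed.

Lemma supp_inZ z u a b : supp_in u a b -> supp_in (fun x => z * u x) a b.
Proof. by move=> su x; rewrite mulf_eq0 negb_or => /andP[_ /su]. Qed.

Lemma supp_inD u v a b : supp_in u a b -> supp_in v a b ->
  supp_in (fun x => u x + v x) a b.
Proof.
move=> su sv x; apply: contraNT => h.
by rewrite (supp_in_out su)// (supp_in_out sv)// addr0.
Qed.

(** The zero function, needed for homogeneity, is [-1] times itself plus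
    itself. *)
Lemma functional_scale (L : (R -> R[i]) -> R[i]) (a b : R) v (z : R[i]) :
  (forall v w (z : R[i]), ccontinuous v -> ccontinuous w ->
    supp_in v a b -> supp_in w a b ->
    L (fun x => z * v x + w x) = z * L v + L w) ->
  ccontinuous v -> supp_in v a b -> L (fun x => z * v x) = z * L v.
Proof.
move=> L_lin cv sv; have c0 := @ccontinuous_cst R 0.
have s0 : supp_in (fun=> 0 : R[i]) a b by move=> x; rewrite eqxx.
have L0 : L (fun=> 0) = 0.
  have := L_lin _ _ (-1) c0 c0 s0 s0.
  rewrite [-1 * L _]mulN1r addNr => h; rewrite -[RHS]h; congr (L _).
  by apply/funext => x; rewrite mulr0 addr0.
rewrite -[RHS]addr0 -L0 -(L_lin _ _ z cv c0 sv s0); congr (L _).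
by apply/funext => x; rewrite addr0.
Qed.

(** The value at the end point is the limit of the zero values outside. It is
    what allows half-open cells [(x, y]] to miss the left end point. *)
Lemma supp_in_end u (a b : R) : ccontinuous u -> supp_in u a b -> u a = 0.
Proof.
move=> cu su; apply: cmod_le_eq0 => e e0.
have /nbhs_ballP[d /= d0 h] := ccontinuous_near a cu e0.
have : cmod (u (a - d / 2) - u a) <= e.
  by apply: h; rewrite /ball /= opprB subrKC gtr0_norm; lra.
rewrite (@supp_in_out u a b (a - d/2))//; last by apply/negP => /andP[]; lra.
by rewrite sub0r cmodN.
Qed.

Lemma supp_in_spt u a b : supp_in u a b -> spt u `<=` `[a, b].
Proof.
move=> su; rewrite [X in _ `<=` X](_ : _ = closure `[a, b]).
  by apply: closureS => x /su; rewrite /= in_itv.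
by apply/closure_id; exact: interval_closed.
Qed.

Lemma supp_in_compact u a b : supp_in u a b -> compact (spt u).
Proof.
move=> su; apply: (@subclosed_compact _ _ `[a, b]).
- exact: closed_closure.
- exact: segment_compact.
- exact: supp_in_spt.
Qed.

(** Heine-Cantor. Compactness is used on an interval that is larger by [1] on
    each side, so that a pair of close points either lies in it or consists of
    zeros of [u]. *)
Lemma ccontinuous_unif u (a b e : R) : ccontinuous u -> supp_in u a b -> 0 < e ->
  exists2 d, 0 < d & forall x y, `|x - y| <= d -> cmod (u x - u y) <= e.
Proof.
move=> cu su e0.
have cK : compact [set` `[a - 1, b + 1]] by exact: segment_compact.
have e20 : 0 < e / 2 by lra.
have /compact_near_coveringP cov := cK.
have /cov : forall x : R, [set` `[a - 1, b + 1]] x -> \forall x' \near x & d \near 0^'+,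
    forall y, `|x' - y| <= d -> cmod (u x' - u y) <= e.
  move=> x _; have /nbhs_ballP[d /= d0 h] := ccontinuous_near x cu e20.
  have d20 : 0 < d / 2 by lra.
  exists (ball x (d / 2), [set t | t < d / 2]).
    by split => /=; [exact: nbhsx_ballx|exact: nbhs_right_lt].
  move=> [x' t] [/= bx' td] y yt.
  have /h hx' : ball x d x' by rewrite /ball /= in bx' *; lra.
  have /h hy : ball x d y.
    move: bx'; rewrite /ball /= => bx'.
    rewrite (_ : x - y = (x - x') + (x' - y)); last by ring.
    by rewrite (le_lt_trans (ler_normD _ _))//; lra.
  rewrite (_ : _ - _ = (u x' - u x) - (u y - u x)); last by ring.
  by rewrite (le_trans (cmodB _ _))//; lra.
move=> H.
have : \forall d \near 0^'+, 0 < d < 1 /\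
  [set` `[a - 1, b + 1]] `<=` (fun x => forall y, `|x - y| <= d -> cmod (u x - u y) <= e).
  near=> d; split.
    by apply/andP; split; near: d; [exact: nbhs_right_gt|exact: nbhs_right_lt].
  near: d; exact: H.
move=> /filter_ex[d [/andP[d0 d1] hd]]; exists d => // x y xy.
have [xK|xK] := boolP (x \in `[a - 1, b + 1]); first exact: hd.
have ux : u x = 0.
  apply: (supp_in_out su); apply: contra xK => /andP[? ?]; rewrite in_itv/=.
  by apply/andP; split; lra.
have uy : u y = 0.
  apply: (supp_in_out su); apply: contra xK => /andP[? ?]; rewrite in_itv/=.
  by move: xy; rewrite ler_distl => /andP[? ?]; apply/andP; split; lra.
by rewrite ux uy subrr cmod0 ltW.
Unshelve. all: by end_near. Qed.

End support.

(** * Riemann sums for charges and local measures *)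

Section step_approximation.
Context d (T : measurableType d) (R : realType) (m : {measure set T -> \bar R}).
Variables (D : set T) (mD : measurable D) (finD : (m D < +oo)%E).
Variables (J : nat -> set T) (c : nat -> R).
Hypothesis mJ : forall k, measurable (J k).
Hypothesis JD : forall k, J k `<=` D.

Let step n (x : T) : R := \sum_(0 <= k < n) c k * \1_(J k) x.

Let integrable_bounded (g : T -> R) (M : R) :
  measurable_fun D g -> (forall x, D x -> `|g x| <= M) ->
  m.-integrable D (EFin \o g).
Proof.
move=> mg gM; apply: measurable_bounded_integrable => //.
exists M; split; first exact: num_real.
by move=> N MN x Dx /=; rewrite (le_trans (gM _ Dx))// ltW.
Qed.

Let measurable_step n : measurable_fun D (step n).
Proof.
apply: measurable_sum => k; apply: measurable_funM; first exact: measurable_cst.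
exact: measurable_indic.
Qed.

Let step_le n x : `|step n x| <= \sum_(0 <= k < n) `|c k|.
Proof.
rewrite (le_trans (ler_norm_sum _ _ _))// ler_sum// => k _.
rewrite normrM ler_piMr// indicE.
by case: (_ \in _); rewrite ?normr1 ?normr0.
Qed.

Let integrable_step n : m.-integrable D (EFin \o step n).
Proof. by apply: (@integrable_bounded _ (\sum_(0 <= k < n) `|c k|)). Qed.

Let Rintegral_step n :
  \int[m]_(x in D) step n x = \sum_(0 <= k < n) c k * fine (m (J k)).
Proof.
elim: n => [|n ih].
  rewrite big_nil (_ : (fun _ => _) = cst 0).
    by rewrite Rintegral_cst// mul0r.
  by apply/funext => x; rewrite /step big_nil.
have iJ : m.-integrable D (EFin \o \1_(J n)).
  apply: (@integrable_bounded _ 1); first exact: measurable_indic.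
  by move=> x _; rewrite indicE; case: (_ \in _); rewrite ?normr1 ?normr0.
rewrite big_nat_recr//= -ih.
rewrite (_ : (fun _ => _) = (fun x => step n x + c n * \1_(J n) x)); last first.
  by apply/funext => x; rewrite /step big_nat_recr.
rewrite RintegralD//; last first.
  apply: (@integrable_bounded _ `|c n|).
    by apply: measurable_funM; [exact: measurable_cst|exact: measurable_indic].
  move=> x _; rewrite normrM ler_piMr// indicE.
  by case: (_ \in _); rewrite ?normr1 ?normr0.
by rewrite RintegralZl// /Rintegral integral_indic// setIidl.
Qed.

(** Compare [g] with the step function that has the value [c k] on [J k]: they
    differ by at most [e], and the integral of the latter is the sum. *)
Lemma Rintegral_step_approx (g : T -> R) n (e : R) : 0 <= e ->
  measurable_fun D g -> trivIset setT J ->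
  (forall x, D x -> (forall k, (k < n)%N -> ~ J k x) -> g x = 0) ->
  (forall k x, (k < n)%N -> J k x -> `|g x - c k| <= e) ->
  `|\int[m]_(x in D) g x - \sum_(0 <= k < n) c k * fine (m (J k))|
    <= e * fine (m D).
Proof.
move=> e0 mg tJ g0 ge.
have gs x : D x -> `|g x - step n x| <= e.
  move=> Dx; have [[k [kn Jkx]]|noJ] := pselect (exists k, (k < n)%N /\ J k x).
    rewrite (_ : step n x = c k); first exact: ge.
    rewrite /step (bigD1_seq k) ?iota_uniq ?mem_index_iota//=.
    rewrite indicE mem_set// mulr1 big1 ?addr0// => i ik.
    rewrite indicE memNset ?mulr0// => Jix.
    move/eqP : ik; apply; apply: (tJ i k I I).
    by exists x.
  rewrite g0//; last by move=> k kn Jkx; apply: noJ; exists k.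
  rewrite /step big_nat_cond big1 ?subrr ?normr0// => i; rewrite andbT => /andP[_ ni].
  by rewrite indicE memNset ?mulr0// => Jix; apply: noJ; exists i.
have ig : m.-integrable D (EFin \o g).
  apply: (@integrable_bounded _ (e + \sum_(0 <= k < n) `|c k|)) => // x Dx.
  rewrite -[g x](subrK (step n x)) (le_trans (ler_normD _ _))// lerD//.
  exact: gs.
rewrite -Rintegral_step -RintegralB//.
have igs : m.-integrable D (EFin \o (fun x => g x - step n x)).
  apply: (@integrable_bounded _ e) => //.
  exact: (measurable_funB mg (measurable_step n)).
rewrite (le_trans (le_normr_Rintegral _ _))// -Rintegral_cst//.
apply: le_Rintegral => //.
  apply: (@integrable_bounded _ e); last by move=> x Dx; rewrite normr_id gs.
  by apply: measurableT_comp => //; exact: (measurable_funB mg (measurable_step n)).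
by apply: (@integrable_bounded _ e) => // x _; rewrite ger0_norm.
Qed.

End step_approximation.

Section grids.
Context {R : realType}.
Implicit Types (A B x : R) (n k : nat).

Definition grid A B n k : R := A + k%:R * ((B - A) / n%:R).

Definition cell A B n k : set R := `]grid A B n k, grid A B n k.+1].

Lemma grid0 A B n : grid A B n 0 = A.
Proof. by rewrite /grid mul0r addr0. Qed.

Lemma grid_end A B n : grid A B n.+1 n.+1 = B.
Proof. by rewrite /grid mulrC divfK ?pnatr_eq0// addrC subrK. Qed.

Lemma le_grid A B n k l : A <= B -> (k <= l)%N -> grid A B n k <= grid A B n l.
Proof.
move=> AB kl; rewrite lerD2l ler_wpM2r ?ler_nat// divr_ge0// ?subr_ge0//.
Qed.

Lemma measurable_cell A B n k : measurable (cell A B n k).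
Proof. exact: measurable_itv. Qed.

Lemma cellP A B n k x :
  cell A B n k x <-> grid A B n k < x <= grid A B n k.+1.
Proof. by rewrite /cell /= in_itv. Qed.

Lemma trivIset_cell A B n : A <= B -> trivIset setT (cell A B n).
Proof.
move=> AB i j _ _ [x [/cellP/andP[ix xi] /cellP/andP[jx xj]]].
apply/eqP; rewrite eqn_leq; apply/andP; split; rewrite leqNgt; apply/negP => lt.
- have := @le_grid A B n _ _ AB lt; lra.
- have := @le_grid A B n _ _ AB lt; lra.
Qed.

(** [k.+1] is the least index whose grid point is not to the left of [x]. *)
Lemma cell_cover A B n x : A < x <= B ->
  exists k, (k < n.+1)%N /\ cell A B n.+1 k x.
Proof.
move=> /andP[Ax xB].
have ex : exists k, x <= grid A B n.+1 k by exists n.+1; rewrite grid_end.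
have [k xk kmin] := ex_minnP ex.
case: k xk kmin => [|k] xk kmin; first by move: xk; rewrite grid0; lra.
exists k; split; first by apply: kmin; rewrite grid_end.
apply/cellP; rewrite xk andbT ltNge; apply/negP => /kmin.
by rewrite ltnn.
Qed.

Lemma cell_sub A B n k x : A <= B -> (k < n.+1)%N -> cell A B n.+1 k x ->
  A < x <= B.
Proof.
move=> AB kn /cellP/andP[kx xk].
have := @le_grid A B n.+1 _ _ AB kn; rewrite grid_end.
have := @le_grid A B n.+1 _ _ AB (leq0n k); rewrite grid0.
by move=> ? ?; apply/andP; split; lra.
Qed.

Lemma cell_dist A B n k x : A <= B -> cell A B n k x ->
  `|x - grid A B n k| <= (B - A) / n%:R.
Proof.
move=> AB /cellP/andP[kx]; rewrite ger0_norm; last by lra.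
by rewrite /grid -natr1; lra.
Qed.

Lemma mesh_cvg A B (e : R) : 0 < e ->
  exists N, forall n, (N <= n)%N -> (B - A) / n.+1%:R <= e.
Proof.
move=> e0; exists (Num.truncn ((B - A) / e)) => n Nn.
rewrite ler_pdivrMr ?ltr0n// mulrC -ler_pdivrMr//.
rewrite (le_trans (ltW (truncnS_gt _)))// ler_nat ltnS//.
Qed.

End grids.

Section charge_riemann_sums.
Context {R : realType}.
Implicit Types (nu : {charge set (measurableTypeR R) -> \bar R}) (g : R -> R).

Let continuous_unif g A B (e : R) : continuous g ->
  (forall x, g x != 0 -> A <= x <= B) -> 0 < e ->
  exists2 d, 0 < d & forall x y, `|x - y| <= d -> `|g x - g y| <= e.
Proof.
move=> cg sg e0.
have sg' : supp_in (fun x => (g x)%:C) A B.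
  by move=> x h; apply: sg; apply: contra h => /eqP ->.
have [d d0 h] := ccontinuous_unif (ccontinuousR cg) sg' e0.
by exists d => // x y /h; rewrite -rmorphB cmodR.
Qed.

(** By uniform continuity of [g] and finiteness of the two Jordan parts. The
    set [K] that cuts the cells serves to compare two charges that agree only
    inside [K]. *)
Lemma charge_integral_riemann nu g (K : set R) A B (e : R) : A < B ->
  continuous g -> (forall x, g x != 0 -> A <= x <= B) ->
  measurable K -> (forall x, g x != 0 -> K x) -> 0 < e ->
  exists N, forall n, (N <= n)%N ->
    `|charge_integral nu g - \sum_(0 <= k < n.+1)
        g (grid A B n.+1 k) * fine (nu (cell A B n.+1 k `&` K))| <= e.
Proof.
move=> AB cg sg mK gK e0.
set P := jordan_pos (hahn_setP nu); set N := jordan_neg (hahn_setP nu).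
have tv0 : 0 <= fine (P setT) + fine (N setT).
  by rewrite addr_ge0// fine_ge0.
set tv := fine (P setT) + fine (N setT) in tv0.
have e10 : 0 < e / (tv + 1) by rewrite divr_gt0//; lra.
have [d d0 gd] := continuous_unif cg sg e10.
have [M hM] := @mesh_cvg R A B d d0.
exists M => n Mn; have AB' := ltW AB.
pose J k := cell A B n.+1 k `&` K.
have mJ k : measurable (J k) by apply: measurableI => //; exact: measurable_cell.
have tJ : trivIset setT J.
  by apply: trivIset_setIr; exact: trivIset_cell.
have g0 (x : R) : setT x -> (forall k, (k < n.+1)%N -> ~ J k x) -> g x = 0.
  move=> _ nJ; apply/eqP/negP => /negP gx.
  have /andP[Ax xB] := sg _ gx.
  move: Ax; rewrite le_eqVlt => /orP[/eqP Ax|Ax].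
    suff : (g A)%:C = 0 by case=> gA; move: gx; rewrite -Ax gA eqxx.
    apply: (@supp_in_end _ (fun x => (g x)%:C) A B); first exact: ccontinuousR.
    by move=> y h; apply: sg; apply: contra h => /eqP ->.
  have [k [kn kx]] := @cell_cover R A B n x ltac:(by rewrite Ax xB).
  by apply: (nJ k kn); split => //; exact: gK.
have gc k (x : R) : (k < n.+1)%N -> J k x -> `|g x - g (grid A B n.+1 k)| <= e / (tv + 1).
  move=> kn [kx _]; apply: gd; rewrite (le_trans (cell_dist AB' kx))//.
  exact: hM.
have mg : measurable_fun setT (g : measurableTypeR R -> measurableTypeR R).
  exact: continuous_measurable_fun.
have PT : (P setT < +oo)%E by rewrite ltey_eq fin_num_measure.
have NT : (N setT < +oo)%E by rewrite ltey_eq fin_num_measure.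
have JT k : J k `<=` setT by [].
have hP := @Rintegral_step_approx _ _ R P setT measurableT PT J (fun k => g (grid A B n.+1 k)) mJ JT
  g n.+1 _ (ltW e10) mg tJ g0 gc.
have hN := @Rintegral_step_approx _ _ R N setT measurableT NT J (fun k => g (grid A B n.+1 k)) mJ JT
  g n.+1 _ (ltW e10) mg tJ g0 gc.
rewrite (_ : \sum_(_ <= _ < _) _ =
  \sum_(0 <= k < n.+1) g (grid A B n.+1 k) * fine (P (J k)) -
  \sum_(0 <= k < n.+1) g (grid A B n.+1 k) * fine (N (J k))); last first.
  rewrite -sumrB; apply: eq_bigr => k _; rewrite -mulrBr; congr (_ * _).
  rewrite (jordan_decomp (hahn_setP nu) (mJ k)) /cadd /=.
  rewrite [cscale _ _ _](_ : _ = - N (J k))%E; last first.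
    by rewrite /cscale EFinN mulN1e.
  have mJk := mJ k; by rewrite fineB// fin_num_measure.
rewrite /charge_integral -/P -/N.
set x := \int[P]_x _ in hP *; set y := \int[N]_x _ in hN *.
set s := \sum_(_ <= _ < _) _ in hP *; set t := \sum_(_ <= _ < _) _ in hN *.
rewrite (_ : _ - _ = (x - s) - (y - t)); last by ring.
rewrite (le_trans (ler_normB _ _))// (le_trans (lerD hP hN))//.
rewrite -mulrDr -/tv mulrAC ler_pdivrMr; last by lra.
by rewrite ler_pM2l//; lra.
Qed.

(** Both integrals are limits of the same Riemann sums, whatever the Jordan
    decompositions of the two charges look like outside [K]. *)
Lemma charge_integral_agree nu nu' g (K : set R) A B : A < B ->
  continuous g -> (forall x, g x != 0 -> A <= x <= B) ->
  measurable K -> (forall x, g x != 0 -> K x) ->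
  (forall X, measurable X -> X `<=` K -> nu X = nu' X) ->
  charge_integral nu g = charge_integral nu' g.
Proof.
move=> AB cg sg mK gK nn.
apply/eqP; rewrite -subr_eq0 -normr_eq0; apply/eqP/le_anti; rewrite normr_ge0 andbT.
apply/ler_addgt0Pr => e e0; rewrite add0r.
have e20 : 0 < e / 2 by lra.
have [N1 h1] := charge_integral_riemann nu AB cg sg mK gK e20.
have [N2 h2] := charge_integral_riemann nu' AB cg sg mK gK e20.
have := h1 _ (leq_maxl N1 N2); have := h2 _ (leq_maxr N1 N2).
set n := maxn _ _.
rewrite (eq_bigr (fun k => g (grid A B n.+1 k) * fine (nu (cell A B n.+1 k `&` K)))); last first.
  move=> k _; rewrite nn//; apply: measurableI => //; exact: measurable_cell.
set s := \sum_(_ <= _ < _) _ => k2 k1.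
rewrite (_ : _ - _ = (charge_integral nu g - s) - (charge_integral nu' g - s)); last by ring.
by rewrite (le_trans (ler_normB _ _))//; lra.
Qed.

End charge_riemann_sums.

Section stieltjes.
Context {R : realType}.
Implicit Types (m : set R -> R[i]) (L : (R -> R[i]) -> R[i]) (u v : R -> R[i]).

Definition rsum m u (A B : R) n : R[i] :=
  \sum_(0 <= k < n) u (grid A B n k) * m (cell A B n k).

(** [L] is integration against the interval function [m], in the sense of
    Riemann and Stieltjes. Linearity, bounds and translation of [L] become
    statements on the values of [m] on half-open intervals, which bypasses the
    Jordan decompositions that define the integral of a charge. *)
Definition stieltjes m L := forall u (A B e : R), A < B -> ccontinuous u ->
  supp_in u A B -> 0 < e -> exists N, forall n, (N <= n)%N ->
    cmod (L u - rsum m u A B n.+1) <= e.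

Lemma stieltjes_unique m m' L L' u A B : A < B ->
  stieltjes m L -> stieltjes m' L' -> ccontinuous u -> supp_in u A B ->
  (forall n k, (k < n.+1)%N -> m (cell A B n.+1 k) = m' (cell A B n.+1 k)) ->
  L u = L' u.
Proof.
move=> AB mL mL' cu su mm; apply/eqP; rewrite -subr_eq0; apply/eqP.
apply: cmod_le_eq0 => e e0; have e20 : 0 < e / 2 by lra.
have [N h] := mL u A B _ AB cu su e20; have [N' h'] := mL' u A B _ AB cu su e20.
have := h _ (leq_maxl N N'); have := h' _ (leq_maxr N N').
set n := maxn _ _.
rewrite (_ : rsum m u A B n.+1 = rsum m' u A B n.+1); last first.
  by rewrite /rsum big_nat_cond [RHS]big_nat_cond; apply: eq_bigr => k /andP[/andP[_ kn] _]; rewrite mm.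
set s := rsum _ _ _ _ _ => k1 k2.
rewrite (_ : _ - _ = (L u - s) - (L' u - s)); last by ring.
by rewrite (le_trans (cmodB _ _))//; lra.
Qed.

Lemma stieltjesB m m' L L' (z : R[i]) : stieltjes m L -> stieltjes m' L' ->
  stieltjes (fun X => m X - z * m' X) (fun u => L u - z * L' u).
Proof.
move=> mL mL' u A B e AB cu su e0.
pose w := cmod z + 1; have w0 : 0 < w by have := cmod_ge0 z; rewrite /w; lra.
have e20 : 0 < e / 2 by lra.
have e3 : 0 < e / 2 / w by rewrite divr_gt0.
have [N h] := mL u A B _ AB cu su e20; have [N' h'] := mL' u A B _ AB cu su e3.
exists (maxn N N') => n; rewrite geq_max => /andP[/h k1 /h' k2].
rewrite (_ : rsum _ _ _ _ _ = rsum m u A B n.+1 - z * rsum m' u A B n.+1); last first.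
  by rewrite /rsum mulr_sumr -sumrB; apply: eq_bigr => k _; ring.
rewrite (_ : _ - _ = (L u - rsum m u A B n.+1) - z * (L' u - rsum m' u A B n.+1));
  last by ring.
rewrite (le_trans (cmodB _ _))// cmodM.
have : cmod z * cmod (L' u - rsum m' u A B n.+1) <= w * (e / 2 / w).
  by rewrite ler_pM ?cmod_ge0// /w; lra.
rewrite mulrCA divff ?gt_eqF// mulr1; lra.
Qed.

Lemma stieltjes_lin m L u v (z : R[i]) A B : stieltjes m L -> A <= B ->
  ccontinuous u -> ccontinuous v -> supp_in u A B -> supp_in v A B ->
  L (fun x => z * u x + v x) = z * L u + L v.
Proof.
move=> mL AB' cu cv su' sv'.
have AB : A - 1 < B by lra.
have su : supp_in u (A - 1) B by apply: supp_in_sub su' => //; lra.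
have sv : supp_in v (A - 1) B by apply: supp_in_sub sv' => //; lra.
apply/eqP; rewrite -subr_eq0; apply/eqP.
apply: cmod_le_eq0 => e e0; have e30 : 0 < e / 3 by lra.
pose w := cmod z + 1; have w0 : 0 < w by have := cmod_ge0 z; rewrite /w; lra.
have ew : 0 < e / 3 / w by rewrite divr_gt0.
have cuv : ccontinuous (fun x => z * u x + v x).
  by apply: ccontinuousD => //; exact: ccontinuousZ.
have suv : supp_in (fun x => z * u x + v x) (A - 1) B.
  by apply: supp_inD => //; exact: supp_inZ.
have [N1 h1] := mL _ _ _ _ AB cu su ew; have [N2 h2] := mL _ _ _ _ AB cv sv e30.
have [N3 h3] := mL _ _ _ _ AB cuv suv e30.
pose n := maxn N1 (maxn N2 N3).
have {}h1 : _ := h1 n (leq_maxl _ _).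
have {}h2 := h2 n ltac:(by rewrite !leq_max leqnn orbT).
have {}h3 := h3 n ltac:(by rewrite !leq_max leqnn !orbT).
set s1 := rsum _ _ _ _ _ in h1; set s2 := rsum _ _ _ _ _ in h2.
rewrite (_ : rsum _ _ _ _ _ = z * s1 + s2) in h3; last first.
  by rewrite /s1 /s2 /rsum mulr_sumr -big_split /=; apply: eq_bigr => k _; ring.
move: h3; set l := L (fun _ => _) => h3.
rewrite (_ : _ - _ = (l - (z * s1 + s2)) - z * (L u - s1) - (L v - s2)); last by ring.
rewrite (le_trans (cmodB _ _))// (_ : e = e / 3 + e / 3 + e / 3); last by field.
rewrite lerD// (le_trans (cmodB _ _))// lerD// cmodM.
rewrite [leRHS](_ : _ = w * (e / 3 / w)); last by field; rewrite gt_eqF.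
by rewrite ler_pM ?cmod_ge0// /w; lra.
Qed.

Lemma stieltjesZ m L u (z : R[i]) A B : stieltjes m L -> A <= B ->
  ccontinuous u -> supp_in u A B -> L (fun x => z * u x) = z * L u.
Proof.
move=> mL AB; apply: functional_scale => v w y cv cw sv sw.
exact: stieltjes_lin mL AB cv cw sv sw.
Qed.

(** A bound for the variation along arbitrarily fine grids suffices, since the
    Riemann sums converge. *)
Lemma stieltjes_bound m L u A B (V s : R) : stieltjes m L -> A < B ->
  ccontinuous u -> supp_in u A B -> (forall x, cmod (u x) <= s) ->
  (forall N, exists2 n, (N <= n)%N &
    \sum_(0 <= k < n.+1) cmod (m (cell A B n.+1 k)) <= V) ->
  cmod (L u) <= s * V.
Proof.
move=> mL AB cu su us mV; apply/ler_addgt0Pr => e e0.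
have [N h] := mL u A B _ AB cu su e0; have [n Nn nV] := mV N.
have s0 : 0 <= s by exact: le_trans (cmod_ge0 _) (us 0).
rewrite (le_trans (cmod_le_sub _ (rsum m u A B n.+1)))// lerD//; last exact: h.
rewrite (le_trans (cmod_sum _ _ _))// (le_trans _ (ler_wpM2l s0 nV))//.
by rewrite mulr_sumr ler_sum// => k _; rewrite cmodM ler_wpM2r ?cmod_ge0.
Qed.

Lemma grid_shift (A B p : R) n k : grid (A + p) (B + p) n k = grid A B n k + p.
Proof. by rewrite /grid (_ : B + p - (A + p) = B - A); ring. Qed.

(** The grid of [[A + p, B + p]] is the translate of that of [[A, B]], so that
    the Riemann sums coincide. *)
Lemma stieltjes_shift m m' L L' u A B p : A < B ->
  stieltjes m L -> stieltjes m' L' -> ccontinuous u -> supp_in u A B ->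
  (forall n k, (k < n.+1)%N ->
    m' (cell A B n.+1 k) = m (cell (A + p) (B + p) n.+1 k)) ->
  L' u = L (fun x => u (x - p)).
Proof.
move=> AB mL mL' cu su mm; apply/eqP; rewrite -subr_eq0; apply/eqP.
have ABp : A + p < B + p by lra.
have cup : ccontinuous (fun x => u (x - p)) by exact: ccontinuous_shift.
have sup : supp_in (fun x => u (x - p)) (A + p) (B + p).
  by move=> x /su /andP[? ?]; apply/andP; split; lra.
apply: cmod_le_eq0 => e e0; have e20 : 0 < e / 2 by lra.
have [N h] := mL _ _ _ _ ABp cup sup e20.
have [N' h'] := mL' u A B _ AB cu su e20.
have := h _ (leq_maxl N N'); have := h' _ (leq_maxr N N').
set n := maxn _ _.
rewrite (_ : rsum m' u A B n.+1 =
    rsum m (fun x => u (x - p)) (A + p) (B + p) n.+1); last first.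
  rewrite /rsum big_nat_cond [RHS]big_nat_cond.
  by apply: eq_bigr => k /andP[/andP[_ kn] _]; rewrite mm// grid_shift addrK.
set s := rsum _ _ _ _ _ => k1 k2.
rewrite (_ : _ - _ = (L' u - s) - (L (fun x => u (x - p)) - s)); last by ring.
by rewrite (le_trans (cmodB _ _))//; lra.
Qed.

End stieltjes.

Section integrals_are_stieltjes.
Context {R : realType}.
Implicit Types (mu : localMeasure R) (u : R -> R[i]).

(** The integral is defined on the support of [u], which varies with [u]; it is
    first moved to the fixed interval [[A, B]], of which every cell is a part. *)
Lemma stieltjes_local mu : stieltjes mu (local_integral mu).
Proof.
move=> u A B e AB cu su e0.
have cK' : compact (`[A, B] : set R) by exact: segment_compact.
rewrite /local_integral; case: pselect => [cK|]; last first.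
  by move/(_ (supp_in_compact su)).
have KK' : spt u `<=` `[A, B] by exact: supp_in_spt.
have mK : measurable (spt u) by apply: closed_measurable; exact: closed_closure.
have [cr ci] := cu.
have sr x : re_part u x != 0 -> A <= x <= B.
  by move=> h; apply: su; apply: contra h; rewrite /re_part => /eqP ->.
have si x : im_part u x != 0 -> A <= x <= B.
  by move=> h; apply: su; apply: contra h; rewrite /im_part => /eqP ->.
have Kr x : re_part u x != 0 -> spt u x.
  by move=> h; apply: subset_closure => /=; apply: contra h; rewrite /re_part => /eqP ->.
have Ki x : im_part u x != 0 -> spt u x.
  by move=> h; apply: subset_closure => /=; apply: contra h; rewrite /im_part => /eqP ->.
have re_eq X : measurable X -> X `<=` spt u -> re_restr mu cK X = re_restr mu cK' X.
  move=> _ XK; rewrite /re_restr !setIidl//; exact: subset_trans KK'.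
have im_eq X : measurable X -> X `<=` spt u -> im_restr mu cK X = im_restr mu cK' X.
  move=> _ XK; rewrite /im_restr !setIidl//; exact: subset_trans KK'.
rewrite /restr_integral.
rewrite (charge_integral_agree AB cr sr mK Kr re_eq).
rewrite (charge_integral_agree AB ci si mK Ki im_eq).
rewrite (charge_integral_agree AB ci si mK Ki re_eq).
rewrite (charge_integral_agree AB cr sr mK Kr im_eq).
have e4 : 0 < e / 4 by lra.
have [N1 h1] := charge_integral_riemann (re_restr mu cK') AB cr sr (@measurableT _ _) (fun x _ => I) e4.
have [N2 h2] := charge_integral_riemann (im_restr mu cK') AB ci si (@measurableT _ _) (fun x _ => I) e4.
have [N3 h3] := charge_integral_riemann (re_restr mu cK') AB ci si (@measurableT _ _) (fun x _ => I) e4.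
have [N4 h4] := charge_integral_riemann (im_restr mu cK') AB cr sr (@measurableT _ _) (fun x _ => I) e4.
exists (maxn N1 (maxn N2 (maxn N3 N4))) => n.
rewrite !geq_max => /and4P[/h1 {}h1 /h2 {}h2 /h3 {}h3 /h4 {}h4].
have cellI k : (k < n.+1)%N -> cell A B n.+1 k `&` setT `&` `[A, B] = cell A B n.+1 k.
  move=> kn; rewrite setIT setIidl// => x /(cell_sub (ltW AB) kn) /andP[? ?].
  by rewrite /= in_itv /=; apply/andP; split; lra.
have resum (g : R -> R) : \sum_(0 <= k < n.+1) g (grid A B n.+1 k) *
    fine (re_restr mu cK' (cell A B n.+1 k `&` setT)) =
    \sum_(0 <= k < n.+1) g (grid A B n.+1 k) * complex.Re (mu (cell A B n.+1 k)).
  rewrite big_nat_cond [RHS]big_nat_cond; apply: eq_bigr => k /andP[/andP[_ kn] _].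
  by rewrite /re_restr cellI.
have imsum (g : R -> R) : \sum_(0 <= k < n.+1) g (grid A B n.+1 k) *
    fine (im_restr mu cK' (cell A B n.+1 k `&` setT)) =
    \sum_(0 <= k < n.+1) g (grid A B n.+1 k) * complex.Im (mu (cell A B n.+1 k)).
  rewrite big_nat_cond [RHS]big_nat_cond; apply: eq_bigr => k /andP[/andP[_ kn] _].
  by rewrite /im_restr cellI.
rewrite resum in h1; rewrite imsum in h2; rewrite resum in h3; rewrite imsum in h4.
set c1 := charge_integral _ _ in h1 *; set c2 := charge_integral _ _ in h2 *.
set c3 := charge_integral _ _ in h3 *; set c4 := charge_integral _ _ in h4 *.
set s1 := \sum_(_ <= _ < _) _ in h1; set s2 := \sum_(_ <= _ < _) _ in h2.
set s3 := \sum_(_ <= _ < _) _ in h3; set s4 := \sum_(_ <= _ < _) _ in h4.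
have ReS : complex.Re (rsum mu u A B n.+1) = s1 - s2.
  rewrite /rsum raddf_sum -sumrB; apply: eq_bigr => k _; rewrite /re_part /im_part /=.
  by case: (u _) => a b; case: (mu _).
have ImS : complex.Im (rsum mu u A B n.+1) = s3 + s4.
  rewrite /rsum raddf_sum -big_split; apply: eq_bigr => k _; rewrite /re_part /im_part /=.
  by case: (u _) => a b; case: (mu _) => c d /=; rewrite addrC.
move: ReS ImS; case: (rsum _ _ _ _ _) => a b ra ib; rewrite /= in ra ib; rewrite ra ib.
rewrite (le_trans (cmod_le_ReIm _))//=.
move: h1 h2 h3 h4; rewrite !ler_norml => /andP[? ?] /andP[? ?] /andP[? ?] /andP[? ?].
have : `|c1 - c2 - (s1 - s2)| <= e / 2 by rewrite ler_norml; apply/andP; split; lra.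
have : `|c3 + c4 - (s3 + s4)| <= e / 2 by rewrite ler_norml; apply/andP; split; lra.
lra.
Qed.

Let Rintegral_riemann (g : R -> R) A B (e : R) : A < B ->
  continuous g -> (forall x, g x != 0 -> A <= x <= B) ->
  0 < e -> exists N, forall n, (N <= n)%N ->
    `|\int[@lebesgue_measure R]_x g x - \sum_(0 <= k < n.+1)
        g (grid A B n.+1 k) * fine (lebesgue_measure (cell A B n.+1 k))| <= e.
Proof.
move=> AB cg sg e0; have AB' := ltW AB.
have sg' : supp_in (fun x => (g x)%:C) A B.
  by move=> x h; apply: sg; apply: contra h => /eqP ->.
have gA : g A = 0.
  suff : (g A)%:C = 0 by case.
  exact: (supp_in_end (ccontinuousR cg) sg').
pose D : set R := [set` `]A, B]].
have mD : measurable D by exact: measurable_itv.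
have lD : lebesgue_measure D = (B - A)%:E.
  by rewrite /D lebesgue_measure_itv /= lte_fin AB.
have BA : 0 < B - A by lra.
have [d d0 gd] := ccontinuous_unif (ccontinuousR cg) sg' (divr_gt0 e0 BA).
have [M hM] := @mesh_cvg R A B d d0.
exists M => n Mn.
rewrite [X in `|X - _|](_ : _ = \int[@lebesgue_measure R]_(x in D) g x); last first.
  rewrite [RHS]Rintegral_mkcond; congr (Rintegral _ _ _); apply/funext => x.
  rewrite patchE; case: ifPn => // xD; apply/eqP/negP => /negP gx.
  have /andP[Ax xB] := sg _ gx; move/negP : xD; apply; rewrite inE /D /= in_itv /= xB andbT.
  by rewrite lt_neqAle Ax andbT; apply: contra gx => /eqP <-; rewrite gA.
pose J k := cell A B n.+1 k `&` D.
have mJ k : measurable (J k) by apply: measurableI => //; exact: measurable_cell.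
have tJ : trivIset setT J by apply: trivIset_setIr; exact: trivIset_cell.
rewrite (eq_big_nat _ _ (F2 := fun k => g (grid A B n.+1 k) * fine (lebesgue_measure (J k)))); last first.
  move=> k /andP[_ kn]; congr (_ * fine (lebesgue_measure _)).
  by rewrite /J setIidl// => x /(cell_sub AB' kn); rewrite /D /= in_itv.
rewrite [leRHS](_ : e = e / (B - A) * fine (lebesgue_measure D)); last first.
  by rewrite lD /= divfK// gt_eqF.
apply: Rintegral_step_approx => //.
- by move: (ltry (B - A)); rewrite -lD.
- by move=> k x [].
- by rewrite divr_ge0// ltW.
- by apply: measurable_funTS; exact: continuous_measurable_fun.
- move=> x; rewrite /D /= in_itv /= => xD nJ.
  have [k [kn kx]] := cell_cover n xD.
  by case: (nJ k kn); split => //; rewrite /D /= in_itv.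
- move=> k x kn [kx _]; rewrite -cmodR rmorphB; apply: gd.
  by rewrite (le_trans (cell_dist AB' kx))// hM.
Qed.

Definition leb (X : set R) : R[i] := (fine (lebesgue_measure X))%:C.

Lemma leb_cell A B n k : A <= B -> leb (cell A B n k) = ((B - A) / n%:R)%:C.
Proof.
move=> AB; rewrite /leb /cell lebesgue_measure_itv /= lte_fin.
have h : grid A B n k.+1 - grid A B n k = (B - A) / n%:R.
  by rewrite /grid -natr1; ring.
case: ltP => [_|gg]; first by rewrite /= h.
congr (_%:C) => /=; apply/le_anti; rewrite divr_ge0 ?subr_ge0//= -h; lra.
Qed.

Lemma stieltjes_leb : stieltjes leb (@cLintegral R).
Proof.
move=> u A B e AB cu su e0; have [cr ci] := cu.
have sr x : re_part u x != 0 -> A <= x <= B.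
  by move=> h; apply: su; apply: contra h; rewrite /re_part => /eqP ->.
have si x : im_part u x != 0 -> A <= x <= B.
  by move=> h; apply: su; apply: contra h; rewrite /im_part => /eqP ->.
have e20 : 0 < e / 2 by lra.
have [N1 h1] := Rintegral_riemann AB cr sr e20.
have [N2 h2] := Rintegral_riemann AB ci si e20.
exists (maxn N1 N2) => n; rewrite geq_max => /andP[/h1 {}h1 /h2 {}h2].
rewrite /cLintegral; set c1 := Rintegral _ _ _ in h1 *.
set c2 := Rintegral _ _ _ in h2 *.
set s1 := \sum_(_ <= _ < _) _ in h1; set s2 := \sum_(_ <= _ < _) _ in h2.
have ReS : complex.Re (rsum leb u A B n.+1) = s1.
  rewrite /rsum raddf_sum; apply: eq_bigr => k _; rewrite /re_part /leb /=.
  by case: (u _) => a b /=; rewrite mulr0 subr0.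
have ImS : complex.Im (rsum leb u A B n.+1) = s2.
  rewrite /rsum raddf_sum; apply: eq_bigr => k _; rewrite /im_part /leb /=.
  by case: (u _) => a b /=; rewrite mulr0 add0r.
move: ReS ImS; case: (rsum _ _ _ _ _) => a b ra ib; rewrite /= in ra ib; rewrite ra ib.
by rewrite (le_trans (cmod_le_ReIm _))//= (splitr e) lerD.
Qed.

End integrals_are_stieltjes.

(** * The measure of the eigenvalue equation *)

Section lipschitz.
Context {R : realType}.
Implicit Types (u : R -> R[i]).

Definition lip u (K : R) := forall x y, cmod (u x - u y) <= K * `|x - y|.

Lemma lip_ccontinuous u K : lip u K -> ccontinuous u.
Proof.
move=> lu; have K0 : 0 <= K.
  by have := le_trans (cmod_ge0 _) (lu 0 1); rewrite sub0r normrN1 mulr1.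
have aux (g : R -> R) : (forall x y, `|g x - g y| <= K * `|x - y|) -> continuous g.
  move=> lg x; apply/cvgrPdist_le => /= e e0; near=> y.
  rewrite (le_trans (lg _ _))//.
  have : `|x - y| <= e / (K + 1).
    near: y; apply/nbhs_normP; exists (e / (K + 1)) => /=; first by rewrite divr_gt0//; lra.
    by move=> y /ltW.
  rewrite ler_pdivlMr; last by lra.
  have := normr_ge0 (x - y); nra.
split; apply: aux => x y; rewrite /re_part /im_part -raddfB.
- exact: le_trans (Re_le_cmod _) (lu _ _).
- exact: le_trans (Im_le_cmod _) (lu _ _).
Unshelve. all: by end_near. Qed.

(** Moduli of difference quotients are bounded by [K], and so is their limit. *)
Lemma lip_derive u K x : lip u K -> norm_derive u x <= K.
Proof.
move=> lu; have K0 : 0 <= K.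
  by have := le_trans (cmod_ge0 _) (lu 0 1); rewrite sub0r normrN1 mulr1.
rewrite /norm_derive; case: asboolP => // -[dr di].
have dq (g : R -> R) : derivable g x 1 ->
    (fun h => h^-1 * (g (h + x) - g x)) @ 0^' --> derive1 g x.
  rewrite derive1E => dg; have := dg; rewrite /derivable => /cvg_ex [l hl].
  have := hl; rewrite (_ : (fun h => h^-1 *: _) =
    (fun h => h^-1 * (g (h + x) - g x))); last first.
    by apply/funext => h; rewrite [h *: _]mulr1.
  move=> hl'; rewrite /derive; move/cvg_lim : hl => /(_ (@Rhausdorff R)) ->.
  exact: hl'.
have hr := dq _ dr; have hi := dq _ di.
rewrite /cderive1n !derive1n1 /cmod /=.
have hs : (fun h => Num.sqrt ((h^-1 * (re_part u (h + x) - re_part u x)) ^+ 2 +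
      (h^-1 * (im_part u (h + x) - im_part u x)) ^+ 2)) @ 0^' -->
    Num.sqrt (derive1 (re_part u) x ^+ 2 + derive1 (im_part u) x ^+ 2).
  apply: continuous_cvg; first exact: sqrt_continuous.
  by apply: cvgD; rewrite !expr2; under eq_fun do rewrite expr2; exact: cvgM.
apply: (cvgr_to_le hs); near=> h.
have h0 : h != 0 by near: h; exact: nbhs_dnbhs_neq.
have := lu (h + x) x; rewrite addrK.
rewrite [X in X <= _ -> _](_ : _ = `|h| * Num.sqrt
   ((h^-1 * (re_part u (h + x) - re_part u x)) ^+ 2 +
   (h^-1 * (im_part u (h + x) - im_part u x)) ^+ 2)).
  by rewrite mulrC ler_pM2r// normr_gt0.
rewrite -sqrtr_sqr -sqrtrM ?sqr_ge0// mulrDr -!exprMn !mulrA !divff// !mul1r.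
by rewrite /re_part /im_part; case: (u (h + x)) => a b; case: (u x).
Unshelve. all: by end_near. Qed.

Lemma lip_sup_norm_derive u : lip u 1 -> (sup_norm_derive u <= 1)%E.
Proof.
move=> lu; rewrite /sup_norm_derive unlock /=; case: ifPn => // _.
apply/ess_supP/aeW => x /=; rewrite lee_fin ger0_norm; first exact: lip_derive.
by rewrite /norm_derive; case: asboolP => // _; exact: cmod_ge0.
Qed.

End lipschitz.

Section eigen_functional.
Context {R : realType}.
Variables (mu : localMeasure R) (lambda : R[i]).
Implicit Types (u v : R -> R[i]).

(** Subtracting [lambda dx] from the measure turns the eigenvalue equation into
    the one for the eigenvalue [0]. *)
Definition nu_integral u := local_integral mu u - lambda * cLintegral u.

Lemma stieltjes_nu : stieltjes (fun X => mu X - lambda * leb X) nu_integral.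
Proof. exact: stieltjesB (stieltjes_local mu) (@stieltjes_leb R). Qed.

(** The cells of [(a, a + 1]], completed by empty sets, are one of the
    partitions over which the total variation is a supremum. *)
Lemma loc_unif_cells : loc_unif mu -> exists2 N : R, 0 <= N & forall a n,
  \sum_(0 <= k < n.+1) cmod (mu (cell a (a + 1) n.+1 k)) <= N.
Proof.
rewrite /loc_unif; set U := unif_norm mu => Ufin.
have cellU a n : ((\sum_(0 <= k < n.+1) cmod (mu (cell a (a + 1) n.+1 k)))%:E <= U)%E.
  have a1 : a <= a + 1 by lra.
  apply: (@le_trans _ _ (local_variation mu [set` `]a, (a + 1)%R]])); last first.
    by apply: ereal_sup_ubound; exists a.
  pose F k := if (k < n.+1)%N then cell a (a + 1) n.+1 k else set0.
  apply: (@le_trans _ _ (\sum_(0 <= k <oo) (cmod (mu (F k)))%:E)%E).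
    apply: le_trans (nneseries_lim_ge n.+1 _); last first.
      by move=> k _ _; rewrite lee_fin cmod_ge0.
    rewrite sumEFin lee_fin big_nat_cond [leRHS]big_nat_cond le_eqVlt.
    by apply/orP; left; apply/eqP/eq_bigr => k /andP[/andP[_ kn] _]; rewrite /F kn.
  apply: ereal_sup_ubound; exists F; split => //.
  - move=> k; rewrite /F; case: ifP => // _; exact: measurable_cell.
  - move=> i j _ _; rewrite /F; case: ifP => _; last by rewrite set0I => -[].
    case: ifP => _; last by rewrite setI0 => -[].
    exact: trivIset_cell.
  - apply/seteqP; split => x /=.
      move=> [k _]; rewrite /F; case: ifP => // kn /(cell_sub a1 kn).
      by rewrite in_itv.
    rewrite in_itv => /(cell_cover n)[k [kn kx]]; exists k => //.
    by rewrite /F kn.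
have U0 : (0 <= U)%E.
  by apply: le_trans (cellU 0 0%N); rewrite lee_fin sumr_ge0// => k _; exact: cmod_ge0.
exists (fine U); first exact: fine_ge0.
move=> a n; rewrite -lee_fin fineK; first exact: cellU.
by rewrite ge0_fin_numE.
Qed.

Lemma nu_lin u v (z : R[i]) A B : A <= B ->
  ccontinuous u -> ccontinuous v -> supp_in u A B -> supp_in v A B ->
  nu_integral (fun x => z * u x + v x) = z * nu_integral u + nu_integral v.
Proof. exact: stieltjes_lin stieltjes_nu. Qed.

Let cell_regroup (a : R) j n i k : (k < n.+1)%N ->
  cell a (a + j.+1%:R) (j.+1 * n.+1) (i * n.+1 + k) =
  cell (a + i%:R) (a + i%:R + 1) n.+1 k.
Proof.
move=> kn.
have gr l : grid a (a + j.+1%:R) (j.+1 * n.+1) (i * n.+1 + l) =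
    grid (a + i%:R) (a + i%:R + 1) n.+1 l.
  rewrite /grid natrD !natrM; field.
  by rewrite !nat1r !pnatr_eq0.
by rewrite /cell gr -addnS gr.
Qed.

(** The interval [[a, b]] is covered by at most [b - a + 1] unit intervals, and
    the variation of the measure on each of them is bounded uniformly. *)
Lemma nu_bound : loc_unif mu -> exists2 N : R, 0 < N & forall u a b s,
  a <= b -> ccontinuous u -> supp_in u a b -> (forall x, cmod (u x) <= s) ->
  cmod (nu_integral u) <= N * (b - a + 1) * s.
Proof.
move=> /loc_unif_cells[M M0 hM]; pose l := cmod lambda.
have l0 : 0 <= l by exact: cmod_ge0.
exists (M + l + 1); first by lra.
move=> u a b s ab cu su us.
have s0 : 0 <= s by exact: le_trans (cmod_ge0 _) (us 0).
set j := Num.truncn (b - a).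
have /andP[j1 j2] : j%:R <= b - a < j.+1%:R by apply: truncn_itv; lra.
have su' : supp_in u a (a + j.+1%:R) by apply: supp_in_sub su; lra.
have aj : a < a + j.+1%:R by rewrite ltrDl ltr0n.
apply: (@le_trans _ _ (s * (j.+1%:R * (M + l)))); last first.
  rewrite mulrC ler_wpM2r// mulrC.
  apply: ler_pM; rewrite ?ler0n//; first by lra.
    by lra.
  by rewrite -natr1; lra.
apply: (stieltjes_bound stieltjes_nu aj cu su' us) => n0.
exists (j.+1 * n0.+1).-1.
  by rewrite -ltnS prednK ?muln_gt0//; exact: leq_pmull.
rewrite prednK ?muln_gt0// big_nat_mul.
apply: (@le_trans _ _ (\sum_(0 <= i < j.+1) (M + l))); last first.
  by rewrite sumr_const_nat subn0 -[leLHS]mulr_natl.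
apply: ler_sum_nat => i _; rewrite mulSn addnC -{1}[(i * _)%N]add0n big_addn addKn.
apply: (@le_trans _ _ (\sum_(0 <= k < n0.+1)
   (cmod (mu (cell (a + i%:R) (a + i%:R + 1) n0.+1 k)) + l / n0.+1%:R))).
  apply: ler_sum_nat => k /andP[_ kn]; rewrite addnC cell_regroup//.
  rewrite (le_trans (cmodB _ _))// lerD2l cmodM leb_cell; last by lra.
  rewrite cmodR ger0_norm; last by rewrite divr_ge0//; lra.
  by rewrite (_ : a + i%:R + 1 - (a + i%:R) = 1) ?mul1r//; ring.
rewrite big_split /= lerD//.
by rewrite sumr_const_nat subn0 -[leLHS]mulr_natr divfK ?pnatr_eq0.
Qed.

Let cell_shift (A B p : R) n k :
  cell (A + p) (B + p) n k = shift_set p (cell A B n k).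
Proof.
rewrite shift_setE; apply/seteqP; split => x; rewrite /= => /cellP/andP[k1 k2];
  apply/cellP; rewrite !grid_shift in k1 k2 *; apply/andP; split; lra.
Qed.

Let cLintegral_shift u A B p : A <= B -> ccontinuous u -> supp_in u A B ->
  cLintegral u = cLintegral (fun x => u (x - p)).
Proof.
move=> AB' cu su'; have AB : A - 1 < B by lra.
have su : supp_in u (A - 1) B by apply: supp_in_sub su'; lra.
apply: (stieltjes_shift AB (@stieltjes_leb R) (@stieltjes_leb R) cu su) => n k kn.
by rewrite !leb_cell; [|lra|lra]; congr (_ / _)%:C; ring.
Qed.

Let local_integral_translate u A B p : A <= B -> ccontinuous u -> supp_in u A B ->
  local_integral (local_sub mu (local_translate p mu)) u =
  local_integral mu u - local_integral mu (fun x => u (x - p)).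
Proof.
move=> AB' cu su'; have AB : A - 1 < B by lra.
have su : supp_in u (A - 1) B by apply: supp_in_sub su'; lra.
pose L' := local_integral (local_translate p mu).
have -> : local_integral mu (fun x => u (x - p)) = L' u.
  apply/esym; apply: (stieltjes_shift AB (stieltjes_local mu) (@stieltjes_local R _) cu su).
  by move=> n k kn; rewrite cell_shift.
rewrite (stieltjes_unique AB (@stieltjes_local R _)
  (stieltjesB 1 (stieltjes_local mu) (@stieltjes_local R (local_translate p mu))) cu su).
  by rewrite mul1r.
by move=> n k kn; rewrite mul1r.
Qed.

(** The Lebesgue part of [mu - lambda dx] is translation invariant, so only
    [mu] contributes to the difference; the weak norm is homogeneous, which
    accounts for a Lipschitz constant [K] other than [1]. *)
Lemma nu_gordon (C X : R) : 0 < C -> weak_gordon C mu ->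
  exists p, [/\ X <= p, 0 < p & forall u a b K, a <= b -> 0 < K -> lip u K ->
    supp_in u a b -> - p <= a -> b <= p -> b - a <= 2 ->
    cmod (nu_integral u - nu_integral (fun x => u (x - p))) <= K * expR (- (C * p))].
Proof.
move=> C0 [p [p0 pX hp]].
have /fine_cvgP[hfin hcvg] := hp.
have /cvgr0Pnorm_lt/(_ 1 ltr01) hsmall := hcvg.
have hX : \forall m \near \oo, X <= p m by move/cvgryPge : pX; exact.
have : \forall m \near \oo, X <= p m /\ ((expR (C * p m))%:E *
      dual_lipschitz_norm (local_sub mu (local_translate (p m) mu))
        `[(- p m)%R, p m] <= 1)%E.
  apply: filterS3 hX hfin hsmall => m mX mf ms; split => //.
  by rewrite -(fineK mf) lee_fin (le_trans (ler_norm _))// ltW.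
move=> /filter_ex[m [Xp hm]]; exists (p m); split => // u a b K ab K0 lu su pa bp ba.
have cu := lip_ccontinuous lu.
rewrite /nu_integral -(cLintegral_shift (p m) ab cu su).
rewrite (_ : _ - _ = local_integral mu u - local_integral mu (fun x => u (x - p m))); last by ring.
rewrite -(local_integral_translate _ ab cu su).
pose w : R[i] := K^-1%:C; pose v := fun x => w * u x.
have Ki : 0 < K^-1 by rewrite invr_gt0.
have Kw : K%:C * w = 1 by rewrite /w -rmorphM divff ?gt_eqF.
set m' := local_sub _ _ in hm *.
have -> : local_integral m' u = K%:C * local_integral m' v.
  by rewrite (stieltjesZ w (stieltjes_local m') ab cu su) mulrA Kw mul1r.
rewrite cmodRM; last exact: ltW.
rewrite ler_pM2l// expRN -[leRHS]mul1r ler_pdivlMr ?expR_gt0// mulrC -lee_fin EFinM.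
apply: le_trans hm; rewrite lee_pmul2l ?lte_fin ?expR_gt0//.
have lv : lip v 1.
  move=> x y; rewrite /v -mulrBr cmodRM; last exact: ltW.
  rewrite mul1r.
  by rewrite -ler_pdivlMl// invrK.
apply: ereal_sup_ubound; exists v => //; split.
- by exists 1.
- have sv : supp_in v a b by exact: supp_inZ.
  apply: subset_trans (supp_in_spt sv) _ => x; rewrite /= !in_itv /= => /andP[? ?].
  by apply/andP; split; lra.
- have sv : supp_in v a b by exact: supp_inZ.
  move=> x y /(supp_in_spt sv) + /(supp_in_spt sv); rewrite /= !in_itv /= => /andP[? ?] /andP[? ?].
  by rewrite ler_norml; apply/andP; split; lra.
- exact: lip_sup_norm_derive.
Unshelve. all: by end_near. Qed.

End eigen_functional.

(** * The eigenvalue equation without derivatives *)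

Section smooth_functions.
Context {R : realType}.
Implicit Types (f g : R -> R).

(** Differentiability everywhere with a given derivative: closure properties
    become equations between functions. *)
Definition derives f g := forall x : R, is_derive x (1 : R) f (g x).

Lemma derives_derive1 f g : derives f g -> derive1 f = g.
Proof. by move=> fg; apply/funext => x; rewrite derive1E; have [] := fg x. Qed.

Lemma derives_continuous f g : derives f g -> continuous f.
Proof.
by move=> fg x; apply/differentiable_continuous/derivable1_diffP; have [] := fg x.
Qed.

Lemma derives_cst (c : R) : derives (fun=> c) (fun=> 0).
Proof. by move=> x; exact: is_derive_cst. Qed.

Lemma derives_id : derives id (fun=> 1).
Proof. by move=> x; exact: is_derive_id. Qed.

Lemma derivesD f f' g g' : derives f f' -> derives g g' ->
  derives (fun x => f x + g x) (fun x => f' x + g' x).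
Proof. by move=> hf hg x; exact: (is_deriveD (hf x) (hg x)). Qed.

Lemma derivesM f f' g g' : derives f f' -> derives g g' ->
  derives (fun x => f x * g x) (fun x => f x * g' x + g x * f' x).
Proof. by move=> hf hg x; exact: (is_deriveM (hf x) (hg x)). Qed.

Lemma derivesV f f' : (forall x, f x != 0) -> derives f f' ->
  derives (fun x => (f x)^-1) (fun x => - (f' x * ((f x)^-1 * (f x)^-1))).
Proof.
move=> f0 hf x; apply: (is_derive_eq (is_deriveV (f0 x) (hf x))).
rewrite -exprVn expr2 [_ *: _]mulNr; congr (- _); exact: mulrC.
Qed.

Lemma derives_affine f f' (k l : R) : derives f f' ->
  derives (fun x => f (k * x + l)) (fun x => k * f' (k * x + l)).
Proof.
move=> hf x.
have h : is_derive x (1 : R) (fun y : R => k * y + l) k.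
  apply: (is_derive_eq (is_deriveD (is_deriveM (is_derive_cst k x 1) (is_derive_id x 1)) (is_derive_cst l x 1))).
  by rewrite /GRing.scale /= mulr1 mulr0 !addr0.
by apply: (is_derive_eq (is_derive1_comp (hf _) h)); exact: mulrC.
Qed.

(** [n] times differentiable. The successive derivatives are existentially
    quantified, so that sums, products, inverses and affine substitutions are
    handled by induction on [n], without formulas for higher derivatives. *)
Fixpoint smoothn (n : nat) f : Prop :=
  if n is n'.+1 then exists2 f', derives f f' & smoothn n' f' else True.

Lemma smoothnW n f : smoothn n.+1 f -> smoothn n f.
Proof. by elim: n f => // n ih f [f' hf /ih hf']; exists f'. Qed.

Lemma smoothn_cst n (c : R) : smoothn n (fun=> c).
Proof. by elim: n c => // n ih c; exists (fun=> 0) => //; exact: derives_cst. Qed.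

Lemma smoothn_id n : smoothn n id.
Proof. by case: n => // n; exists (fun=> 1); [exact: derives_id|exact: smoothn_cst]. Qed.

Lemma smoothnD n f g : smoothn n f -> smoothn n g -> smoothn n (fun x => f x + g x).
Proof.
elim: n f g => // n ih f g [f' hf sf] [g' hg sg].
by exists (fun x => f' x + g' x); [exact: derivesD|exact: ih].
Qed.

Lemma smoothnM n f g : smoothn n f -> smoothn n g -> smoothn n (fun x => f x * g x).
Proof.
elim: n f g => // n ih f g sf sg; have := sf => -[f' hf sf']; have := sg => -[g' hg sg'].
exists (fun x => f x * g' x + g x * f' x); first exact: derivesM.
by apply: smoothnD; apply: ih => //; exact: smoothnW.
Qed.

Lemma smoothnV n f : (forall x, f x != 0) -> smoothn n f ->
  smoothn n (fun x => (f x)^-1).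
Proof.
move=> f0; elim: n => // n ih sf; have := sf => -[f' hf sf'].
exists (fun x => - (f' x * ((f x)^-1 * (f x)^-1))); first exact: derivesV.
rewrite (_ : (fun _ => _) = (fun x => -1 * (f' x * ((f x)^-1 * (f x)^-1)))); last first.
  by apply/funext => x; rewrite mulN1r.
have sV : smoothn n (fun x => (f x)^-1) by apply: ih; exact: smoothnW.
apply: smoothnM; first exact: smoothn_cst.
by apply: smoothnM => //; exact: smoothnM.
Qed.

Lemma smoothn_affine n f (k l : R) : smoothn n f -> smoothn n (fun x => f (k * x + l)).
Proof.
elim: n f => // n ih f [f' hf sf].
exists (fun x => k * f' (k * x + l)); first exact: derives_affine.
by apply: smoothnM; [exact: smoothn_cst|exact: ih].
Qed.

Lemma smoothn_derivable f : (forall n, smoothn n f) ->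
  forall n x, derivable (derive1n n f) x 1.
Proof.
move=> sf n; have := sf n.+1; elim: n f {sf} => [|n ih] f.
  by move=> [f' hf _] x; have [] := hf x.
by move=> [f' hf sf] x; rewrite derive1Sn (derives_derive1 hf); exact: ih.
Qed.

Lemma csmoothR f : (forall n, smoothn n f) -> csmooth (fun x => (f x)%:C).
Proof.
move=> sf n x; split; rewrite /cderive1n /re_part /im_part /=.
- exact: smoothn_derivable.
- by apply: smoothn_derivable => k; exact: smoothn_cst.
Qed.

Lemma cderive1n2R f f' f'' : derives f f' -> derives f' f'' ->
  cderive1n 2 (fun x => (f x)%:C) = (fun x => (f'' x)%:C).
Proof.
move=> h h'; apply/funext => x; rewrite /cderive1n /re_part /im_part /=.
rewrite (_ : (fun x => f x) = f)// (derives_derive1 h) (derives_derive1 h').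
by rewrite (derives_derive1 (derives_cst 0)) (derives_derive1 (derives_cst 0)).
Qed.

End smooth_functions.

Section ramp.
Context {R : realType}.

(** For [k = 0] the classical flat function [exp (- 1 / x)]; the negative
    powers of [x] make the family stable under derivation. *)
Definition flat k (x : R) : R := if 0 < x then x^-1 ^+ k * expR (- x^-1) else 0.

Let flat_le k x : `|flat k x| <= k.+1`!%:R * `|x|.
Proof.
rewrite /flat; case: ifPn => [x0|_]; last by rewrite normr0 mulr_ge0.
have xi : 0 < x^-1 by rewrite invr_gt0.
rewrite !ger0_norm; [|exact: ltW|by rewrite mulr_ge0 ?expR_ge0// exprn_ge0// ltW].
rewrite expRN ler_pdivrMr ?expR_gt0//.
have := @expR_ge1Dxn _ x^-1 k (ltW xi) => h.
have h' : x^-1 ^+ k.+1 / k.+1`!%:R <= expR x^-1 by lra.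
have f0 : 0 < k.+1`!%:R * x by rewrite mulr_gt0// ltr0n fact_gt0.
rewrite (le_trans _ (ler_wpM2l (ltW f0) h'))// exprS.
have c0 : k.+1`!%:R != 0 :> R by rewrite pnatr_eq0 -lt0n fact_gt0.
move: c0; set y := x^-1 ^+ k; set c := k.+1`!%:R => c0.
by rewrite [leRHS](_ : _ = y)//; field; rewrite c0 gt_eqF.
Qed.

(** At [0] the difference quotient of [flat k] is [flat k.+1], which tends to
    [0] because [exp] dominates powers. *)
Lemma derives_flat k : derives (flat k) (fun x => - k%:R * flat k.+1 x + flat k.+2 x).
Proof.
move=> x; have [x0|x0|->] := ltgtP x 0.
- apply: (@near_eq_is_derive _ _ _ (cst 0)) => //; last first.
    apply: is_derive_eq (is_derive_cst _ _ _) _.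
    by rewrite /flat !ltNge (ltW x0) /= mulr0 addr0.
  near=> y; rewrite /flat ltNge (_ : y <= 0)//; apply: ltW.
  by near: y; exact: lt_nbhsl.
- have xn0 : x != 0 by rewrite gt_eqF.
  apply: (@near_eq_is_derive _ _ _ (fun y : R => (y^-1 ^+ k * expR (- y^-1) : R))) => //.
    by near=> y; rewrite /flat (_ : 0 < y)//; near: y; exact: lt_nbhsr.
  have hV : is_derive x (1 : R) (fun y : R => y^-1) (- x^-1 ^+ 2).
    apply: is_derive_eq (is_deriveV xn0 (is_derive_id x 1)) _.
    by rewrite /GRing.scale /= mulr1 exprVn.
  have hE : is_derive x (1 : R) (fun y : R => expR (- y^-1)) (expR (- x^-1) * x^-1 ^+ 2).
    have hN : is_derive x (1 : R) (fun y : R => - y^-1) (x^-1 ^+ 2).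
      by apply: is_derive_eq (is_deriveN hV) _; rewrite opprK.
    apply: is_derive_eq (is_derive1_comp (is_derive_expR _) hN) _.
    by rewrite mulrC.
  have hP : is_derive x (1 : R) (fun y : R => y^-1 ^+ k) (- k%:R * x^-1 ^+ k.+1).
    elim: k => [|j ih].
      rewrite oppr0 mul0r (_ : (fun _ => _) = cst 1); first exact: is_derive_cst.
      by apply/funext => y; rewrite expr0.
    rewrite (_ : (fun _ => _) = (fun y : R => y^-1 * y^-1 ^+ j)); last first.
      by apply/funext => y; rewrite exprS.
    apply: is_derive_eq (is_deriveM hV ih) _.
    by rewrite /GRing.scale /= !exprS expr0 -natr1; ring.
  apply: is_derive_eq (is_deriveM hP hE) _.
  by rewrite /flat x0 /GRing.scale /= !exprS; ring.
- have z : flat k.+1 0 = 0 /\ flat k.+2 0 = 0 by rewrite /flat ltxx.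
  rewrite z.1 z.2 mulr0 addr0.
  have hl : (fun h : R => h^-1 *: ((flat k \o shift 0) (h *: 1) - flat k 0)) @ 0^' --> (0 : R).
    apply/cvgr0Pnorm_le => e e0; near=> h.
    have h0 : h != 0 by near: h; exact: nbhs_dnbhs_neq.
    rewrite /= addr0 [h *: 1]mulr1 {2}/flat ltxx subr0.
    rewrite (_ : h^-1 *: flat k h = flat k.+1 h).
      rewrite (le_trans (flat_le _ _))//.
      have f0 : 0 < k.+2`!%:R :> R by rewrite ltr0n fact_gt0.
      rewrite mulrC -ler_pdivlMr//.
      near: h; apply: dnbhs0_le; exact: divr_gt0.
    by rewrite /flat; case: ifP => _; rewrite /GRing.scale /= ?mulr0// exprS mulrA.
  constructor; first by apply/cvg_ex; exists 0.
  exact: cvg_lim hl.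
Unshelve. all: by end_near. Qed.

Lemma smoothn_flat n k : smoothn n (flat k).
Proof.
elim: n k => // n ih k; exists (fun x => - k%:R * flat k.+1 x + flat k.+2 x).
  exact: derives_flat.
by apply: smoothnD => //; apply: smoothnM => //; exact: smoothn_cst.
Qed.

Lemma flat_ge0 x : 0 <= flat 0 x.
Proof. by rewrite /flat; case: ifP => // _; rewrite expr0 mul1r expR_ge0. Qed.

Lemma flat_gt0 x : 0 < x -> 0 < flat 0 x.
Proof. by move=> x0; rewrite /flat x0 expr0 mul1r expR_gt0. Qed.

Lemma flat_le0 x : x <= 0 -> flat 0 x = 0.
Proof. by move=> x0; rewrite /flat ltNge x0. Qed.

Definition smooth_step (x : R) := flat 0 x / (flat 0 x + flat 0 (1 - x)).

(** A smooth function that agrees with [max 0 x] outside [[0, 1]]. *)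
Definition ramp (x : R) := x * smooth_step x.

Let den_gt0 x : 0 < flat 0 x + flat 0 (1 - x).
Proof.
have [x0|x0] := ltP 0 x.
  by have := flat_gt0 x0; have := flat_ge0 (1 - x); lra.
have : 0 < 1 - x by lra.
by move=> /flat_gt0; have := flat_ge0 x; lra.
Qed.

Lemma smoothn_ramp n : smoothn n ramp.
Proof.
apply: smoothnM; first exact: smoothn_id.
apply: smoothnM; first exact: smoothn_flat.
apply: smoothnV; first by move=> x; rewrite gt_eqF.
apply: smoothnD; first exact: smoothn_flat.
rewrite (_ : (fun _ => _) = (fun x => flat 0 ((-1) * x + 1))).
  by apply: smoothn_affine; exact: smoothn_flat.
by apply/funext => x; rewrite mulN1r addrC.
Qed.

Lemma ramp_le0 x : x <= 0 -> ramp x = 0.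
Proof. by move=> x0; rewrite /ramp /smooth_step flat_le0// mul0r mulr0. Qed.

Lemma ramp_ge1 x : 1 <= x -> ramp x = x.
Proof.
move=> x1; rewrite /ramp /smooth_step (@flat_le0 (1 - x)); last by lra.
by rewrite addr0 divff ?mulr1// gt_eqF// flat_gt0//; lra.
Qed.

Lemma ramp_dist x : `|ramp x - Num.max 0 x| <= 1.
Proof.
have [x0|x0] := leP x 0; first by rewrite ramp_le0// subr0 normr0.
have [x1|x1] := leP 1 x; first by rewrite ramp_ge1// subrr normr0.
have s01 : 0 <= smooth_step x <= 1.
  rewrite /smooth_step divr_ge0 ?flat_ge0 ?(ltW (den_gt0 _))//=.
  by rewrite ler_pdivrMr// mul1r lerDl flat_ge0.
move: s01; rewrite /ramp => /andP[s0 s1].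
by rewrite ler_norml; apply/andP; split; nra.
Qed.

(** The second derivative of [ramp] vanishes outside [[0, 1]], where [ramp] is
    affine; its integral is [1], the increase of the slope, so that rescaling it
    gives an approximate Dirac mass. *)
Lemma ramp_derivatives : exists f1 f2 : R -> R, [/\ derives ramp f1, derives f1 f2,
  continuous f2, (forall x, x < 0 -> f1 x = 0) /\ (forall x, 1 < x -> f1 x = 1) &
  forall x, f2 x != 0 -> 0 <= x <= 1].
Proof.
have [f1 h1 [f2 h2 [f3 h3 _]]] := @smoothn_ramp 3.
have f1l x : x < 0 -> f1 x = 0.
  move=> x0; have [_ <-] := h1 x.
  suff [_ ->] : is_derive x (1 : R) ramp 0 by [].
  apply: (@near_eq_is_derive _ _ _ (cst 0)) => //.
  near=> y; rewrite ramp_le0//; apply: ltW; near: y; exact: lt_nbhsl.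
have f1r x : 1 < x -> f1 x = 1.
  move=> x1; have [_ <-] := h1 x.
  suff [_ ->] : is_derive x (1 : R) ramp 1 by [].
  apply: (@near_eq_is_derive _ _ _ id) => //.
  near=> y; rewrite ramp_ge1//; apply: ltW; near: y; exact: lt_nbhsr.
exists f1, f2; split => //; first exact: derives_continuous h3.
move=> x f2x; apply/negP => /negP; rewrite negb_and -!ltNge => /orP[x0|x1].
- move/eqP : f2x; apply; have [_ <-] := h2 x.
  suff [_ ->] : is_derive x (1 : R) f1 0 by [].
  apply: (@near_eq_is_derive _ _ _ (cst 0)) => //.
  near=> y; rewrite f1l//; near: y; exact: lt_nbhsl.
- move/eqP : f2x; apply; have [_ <-] := h2 x.
  suff [_ ->] : is_derive x (1 : R) f1 0 by [].
  apply: (@near_eq_is_derive R R R (cst (1 : R))) => //.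
  near=> y; rewrite f1r//; near: y; exact: lt_nbhsr.
Unshelve. all: by end_near. Qed.

End ramp.

Section mollification.
Context {R : realType}.
Implicit Types (u : R -> R[i]).

Lemma cLintegral_bound u (A B s : R) : A < B -> ccontinuous u -> supp_in u A B ->
  (forall x, cmod (u x) <= s) -> cmod (cLintegral u) <= s * (B - A).
Proof.
move=> AB cu su us; apply: (stieltjes_bound (@stieltjes_leb R) AB cu su us) => N.
exists N => //; rewrite (eq_bigr (fun=> (B - A) / N.+1%:R)).
  by rewrite sumr_const_nat subn0 -[leLHS]mulr_natr divfK ?pnatr_eq0.
move=> k _; rewrite leb_cell; last exact: ltW.
by rewrite cmodR ger0_norm// divr_ge0//; lra.
Qed.

Variables (f1 f2 : R -> R).
Hypotheses (f12 : derives f1 f2) (cf2 : continuous f2).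
Hypotheses (f1l : forall x : R, x < 0 -> f1 x = 0) (f1r : forall x : R, 1 < x -> f1 x = 1).
Hypothesis f2s : forall x : R, f2 x != 0 -> 0 <= x <= 1.

(** When [f2] is the second derivative of [ramp], this is the second derivative
    of [x |-> d * ramp ((x - a) / d)]. *)
Definition bump (a d x : R) : R := d^-1 * f2 (d^-1 * x + - (a / d)).

Let scaled (a d x : R) : 0 < d -> d^-1 * x + - (a / d) = (x - a) / d.
Proof. by move=> d0; rewrite mulrBl mulrC. Qed.

Lemma bump_supp (a d x : R) : 0 < d -> bump a d x != 0 -> a <= x <= a + d.
Proof.
move=> d0; rewrite /bump mulf_eq0 negb_or => /andP[_ /f2s]; rewrite scaled//.
rewrite ler_pdivlMr// ler_pdivrMr// mul0r mul1r => /andP[? ?].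
by apply/andP; split; lra.
Qed.

Lemma derives_bump (a d : R) : derives (fun x => f1 (d^-1 * x + - (a / d))) (bump a d).
Proof. exact: derives_affine. Qed.

Lemma continuous_bump (a d : R) : continuous (bump a d).
Proof.
have cl := derives_continuous (derives_affine d^-1 (- (a / d)) (@derives_id R)).
move=> x; exact: (cvgM (cvg_cst d^-1) (continuous_comp (cl x) (@cf2 _))).
Qed.

Lemma Rintegral_bump (a d : R) : 0 < d -> \int[@lebesgue_measure R]_x bump a d x = 1.
Proof.
move=> d0; have lt : a - d < a + 2 * d by lra.
have dF := derives_bump a d; have cF := derives_continuous dF.
have cb := @continuous_bump a d.
rewrite (_ : Rintegral _ _ _ =
   \int[@lebesgue_measure R]_(x in [set` `[(a - d), (a + 2 * d)]]) bump a d x); last first.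
  rewrite [RHS]Rintegral_mkcond; congr (Rintegral _ _ _); apply/funext => x.
  rewrite patchE; case: ifPn => // xD; apply/eqP/negP => /negP /(bump_supp d0) /andP[? ?].
  by move/negP : xD; apply; rewrite inE /= in_itv /=; apply/andP; split; lra.
rewrite /Rintegral (@continuous_FTC2 _ _ (fun x => f1 (d^-1 * x + - (a / d))))//.
- rewrite /= !scaled// f1r ?f1l ?subr0//.
    by rewrite ltr_pdivrMr// mul0r; lra.
  by rewrite ltr_pdivlMr// mul1r; lra.
- exact: continuous_subspaceT.
- split; first by move=> x _; have [] := dF x.
    exact/cvg_at_right_filter/cF.
  exact/cvg_at_left_filter/cF.
- by move=> x _; rewrite (derives_derive1 dF).
Qed.

(** On the support [[a, a + d]] of the bump, [u] differs little from [u a],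
    and the size of the bump is at most [M / d] when [M] bounds [f2]. *)
Lemma bump_dirac u (a e : R) : ccontinuous u -> 0 < e ->
  exists2 d0, 0 < d0 & forall d, 0 < d -> d <= d0 ->
    cmod (cLintegral (fun x => u x * (bump a d x)%:C) - u a) <= e.
Proof.
move=> cu e0.
have [y _ hy] := @cmod_max R (fun x => (f2 x)%:C) 0 1 (ccontinuousR cf2) ler01.
pose M := cmod (f2 y)%:C + 1.
have M0 : 0 < M by have := cmod_ge0 (f2 y)%:C; rewrite /M; lra.
have fM x : `|f2 x| <= M.
  have [->|/f2s x01] := eqVneq (f2 x) 0; first by rewrite normr0 ltW.
  by have := hy _ x01; rewrite cmodR /M; lra.
have eM : 0 < e / M by rewrite divr_gt0.
have /nbhs_ballP[r /= r0 hr] := ccontinuous_near a cu eM.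
exists (r / 2); first by lra.
move=> d d0 dr; have cb := ccontinuousR (@continuous_bump a d).
have sb : supp_in (fun x => (bump a d x)%:C) a (a + d).
  by move=> x h; apply: bump_supp => //; apply: contra h => /eqP ->.
have ad : a < a + d by lra.
have cub : ccontinuous (fun x => u x * (bump a d x)%:C) by exact: ccontinuousM.
have sub : supp_in (fun x => u x * (bump a d x)%:C) a (a + d).
  by move=> x; rewrite mulf_eq0 negb_or => /andP[_ /sb].
have I1 : cLintegral (fun x => (bump a d x)%:C) = 1.
  rewrite /cLintegral /re_part /im_part /= (Rintegral_bump a d0).
  rewrite (_ : Rintegral _ _ _ = 0)//.
  by rewrite /Rintegral integral_cst //= mul0e.
have := stieltjes_lin (- u a) (@stieltjes_leb R) (ltW ad) cb cub sb sub.
rewrite I1 mulr1 addrC => <-.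
apply: (@le_trans _ _ (e / M * (d^-1 * M) * (a + d - a))); last first.
  by rewrite addrAC subrr add0r le_eqVlt; apply/orP; left; apply/eqP; field; rewrite !gt_eqF.
apply: cLintegral_bound => //.
- by apply: ccontinuousD => //; exact: ccontinuousZ.
- by apply: supp_inD => //; exact: supp_inZ.
move=> x; rewrite (_ : _ + _ = (u x - u a) * (bump a d x)%:C); last by ring.
rewrite cmodM.
have [->|/(bump_supp d0)/andP[ax xd]] := eqVneq (bump a d x) 0.
  by rewrite cmod0 mulr0 !mulr_ge0 ?invr_ge0// ltW.
rewrite ler_pM ?cmod_ge0//; first by apply: hr; rewrite /ball /= distrC ger0_norm; lra.
rewrite cmodR /bump normrM gtr0_norm ?invr_gt0// ler_wpM2l//.
by rewrite invr_ge0 ltW.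
Qed.

End mollification.

Section hat.
Context {R : realType}.
Implicit Types (a b c x y : R).

(** The hat function with corners at [a < b < c] and height [(b - a) * (c - b)],
    so normalized that no division occurs. *)
Definition hat a b c x := (c - b) * Num.max 0 (x - a) -
  (c - a) * Num.max 0 (x - b) + (b - a) * Num.max 0 (x - c).

Let max0_lip x y : `|Num.max 0 x - Num.max 0 y| <= `|x - y|.
Proof.
by case: (leP 0 x) => ?; case: (leP 0 y) => ?; rewrite ler_norml;
  case: (ler0P (x - y)) => ?; apply/andP; split; lra.
Qed.

Lemma hat_lip a b c x y : a <= b -> b <= c ->
  `|hat a b c x - hat a b c y| <= 2 * (c - a) * `|x - y|.
Proof.
move=> ab bc.
have h d : `|Num.max 0 (x - d) - Num.max 0 (y - d)| <= `|x - y|.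
  by rewrite (le_trans (max0_lip _ _))// (_ : x - d - (y - d) = x - y)//; ring.
have ha := h a; have hb := h b; have hc := h c.
rewrite /hat (_ : _ - _ = (c - b) * (Num.max 0 (x - a) - Num.max 0 (y - a)) -
  (c - a) * (Num.max 0 (x - b) - Num.max 0 (y - b)) +
  (b - a) * (Num.max 0 (x - c) - Num.max 0 (y - c))); last by ring.
rewrite (le_trans (ler_normD _ _))//.
have h1 := ler_normB ((c - b) * (Num.max 0 (x - a) - Num.max 0 (y - a)))
  ((c - a) * (Num.max 0 (x - b) - Num.max 0 (y - b))).
have n1 : `|c - b| = c - b by rewrite ger0_norm; lra.
have n2 : `|c - a| = c - a by rewrite ger0_norm; lra.
have n3 : `|b - a| = b - a by rewrite ger0_norm; lra.
rewrite !normrM n1 n2 n3 in h1 *.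
nra.
Qed.

Lemma hat_continuous a b c : a <= b -> b <= c -> ccontinuous (fun x => (hat a b c x)%:C).
Proof.
move=> ab bc; apply: (@lip_ccontinuous _ _ (2 * (c - a))) => x y.
by rewrite -rmorphB cmodR hat_lip.
Qed.

Lemma hat_bounds a b c x : a <= b -> b <= c -> 0 <= hat a b c x <= (b - a) * (c - b).
Proof.
move=> ab bc; rewrite /hat.
by case: (leP 0 (x - a)) => ?; case: (leP 0 (x - b)) => ?; case: (leP 0 (x - c)) => ?;
  apply/andP; split; nra.
Qed.

Lemma hat_supp b a c x : a <= b -> b <= c -> hat a b c x != 0 -> a <= x <= c.
Proof.
move=> ab bc; apply: contraNT; rewrite negb_and -!ltNge => /orP[xa|cx]; rewrite /hat.
  by rewrite !max_l; [apply/eqP; ring|lra..].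
by rewrite !max_r; [apply/eqP; ring|lra..].
Qed.

Lemma hatM_supp_in a b c (u : R -> R[i]) : a <= b -> b <= c ->
  supp_in (fun x => (hat a b c x)%:C * u x) a c.
Proof.
move=> ab bc; apply: supp_inM => x h; apply: (@hat_supp b) => //.
by apply: contra h => /eqP ->.
Qed.

End hat.

Section three_point_formula.
Context {R : realType}.
Variables (mu : localMeasure R) (lambda : R[i]) (u : R -> R[i]).
Hypothesis mu_unif : loc_unif mu.
Hypothesis eigen : schrodinger mu u (fun x => lambda * u x).

Let cu : ccontinuous u. Proof. by case: eigen. Qed.

(** Formally this is the equation tested with a hat, whose second derivative
    is a combination of Dirac masses at the corners. The test function [phi] is
    the same combination of scaled ramps as the hat is of positive parts, at
    uniform distance of order [d] from the hat. *)
Lemma three_point a b c : a < b -> b < c ->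
  nu_integral mu lambda (fun x => (hat a b c x)%:C * u x) =
  (c - b)%:C * u a - (c - a)%:C * u b + (b - a)%:C * u c.
Proof.
move=> ab bc; have ab' := ltW ab; have bc' := ltW bc; have ac' : a <= c by lra.
have [ba0 cb0 ca0] : [/\ 0 <= b - a, 0 <= c - b & 0 <= c - a] by split; lra.
apply/eqP; rewrite -subr_eq0; apply/eqP; apply: cmod_le_eq0 => e e0.
have [f1 [f2 [r1 r2 cf2 [f1l f1r] f2s]]] := @ramp_derivatives R.
have [N N0 hN] := nu_bound lambda mu_unif.
have ac1 : a <= c + 1 by lra.
have [y _ hy] := cmod_max cu ac1.
pose U := cmod (u y) + 1; have U0 : 0 < U by have := cmod_ge0 (u y); rewrite /U; lra.
pose q := 2 * (c - a); have q0 : 0 < q by rewrite /q; lra.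
have e20 : 0 < e / 2 by lra.
have eq0 : 0 < e / 2 / q by rewrite divr_gt0.
have [da da0 hda] := bump_dirac r2 cf2 f1l f1r f2s a cu eq0.
have [db db0 hdb] := bump_dirac r2 cf2 f1l f1r f2s b cu eq0.
have [dc dc0 hdc] := bump_dirac r2 cf2 f1l f1r f2s c cu eq0.
pose V := N * (c + 1 - a + 1) * (q * U).
have V0 : 0 < V by rewrite /V !mulr_gt0//; lra.
pose d := Num.min (Num.min 1 (e / 2 / V)) (Num.min da (Num.min db dc)).
have d0 : 0 < d by rewrite /d !lt_min ltr01 !divr_gt0 ?da0 ?db0 ?dc0.
have [d1 dV da' db' dc'] : [/\ d <= 1, d <= e / 2 / V, d <= da, d <= db & d <= dc].
  by rewrite /d; split; rewrite !ge_min lexx ?orbT.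
pose rs (t x : R) := d * ramp (d^-1 * x + - (t / d)).
pose phi x := (c - b) * rs a x + - (c - a) * rs b x + (b - a) * rs c x.
pose phi2 x := (c - b) * bump f2 a d x + - (c - a) * bump f2 b d x + (b - a) * bump f2 c d x.
pose rs1 (t x : R) := f1 (d^-1 * x + - (t / d)).
pose phi1 x := (c - b) * rs1 a x + - (c - a) * rs1 b x + (b - a) * rs1 c x.
have dZ k f f' : derives f f' -> derives (fun x : R => k * f x) (fun x => k * f' x).
  move=> h x; apply: is_derive_eq (derivesM (derives_cst k) h x) _.
  by rewrite mulr0 addr0.
have rs_d t : derives (rs t) (rs1 t).
  move=> x; apply: is_derive_eq (dZ d _ _ (derives_affine d^-1 (- (t / d)) r1) x) _.
  by rewrite mulrA divff ?mul1r// gt_eqF.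
have phi_d : derives phi phi1.
  by apply: derivesD; [apply: derivesD|]; exact: dZ.
have phi1_d : derives phi1 phi2.
  by apply: derivesD; [apply: derivesD|]; apply: dZ; exact: derives_bump.
have phi_s n : smoothn n phi.
  have rss t : smoothn n (rs t).
    apply: smoothnM; first exact: smoothn_cst.
    by apply: smoothn_affine; exact: smoothn_ramp.
  have cs k : smoothn n (fun=> k : R) by exact: smoothn_cst.
  by apply: smoothnD; [apply: smoothnD|]; apply: smoothnM.
have sc t x : d^-1 * x + - (t / d) = (x - t) / d by rewrite mulrBl mulrC.
have phi_supp : supp_in (fun x => (phi x)%:C) a (c + d).
  move=> x; apply: contraNT; rewrite negb_and -!ltNge => /orP[xa|cx].
    rewrite /phi /rs !sc !ramp_le0 ?mulr0 ?addr0// ler_pdivrMr// mul0r; lra.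
  rewrite /phi /rs !sc !ramp_ge1 ?ler_pdivlMr//; try lra.
  have dn0 : d != 0 by rewrite gt_eqF.
  rewrite ![d * _]mulrC !divfK//.
  by rewrite [X in X%:C](_ : _ = 0)//; ring.
have phi_test : test_function (fun x => (phi x)%:C).
  split; first exact: csmoothR.
  exact: supp_in_compact phi_supp.
have cphi : ccontinuous (fun x => (phi x)%:C).
  by apply: ccontinuousR; exact: derives_continuous phi_d.
pose w x := (phi x)%:C * u x.
have cw : ccontinuous w by exact: ccontinuousM.
have sw : supp_in w a (c + 1) by apply: supp_inM; apply: supp_in_sub phi_supp => //; lra.
have [_ _ _ /(_ _ phi_test)] := eigen.
rewrite (_ : (fun x => lambda * u x * _) = (fun x => lambda * w x)); last first.
  by apply/funext => x; rewrite /w; ring.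
rewrite (stieltjesZ lambda (@stieltjes_leb R) ac1 cw sw).
rewrite (cderive1n2R phi_d phi1_d).
rewrite [X in _ + local_integral _ X](_ : _ = w); last first.
  by apply/funext => x; rewrite /w mulrC.
move=> heq.
have hw : nu_integral mu lambda w = cLintegral (fun x => u x * (phi2 x)%:C).
  by rewrite /nu_integral heq; ring.
have cB t : ccontinuous (fun x => u x * (bump f2 t d x)%:C).
  by apply: ccontinuousM => //; apply: ccontinuousR; exact: continuous_bump.
have sB t : a <= t -> t <= c -> supp_in (fun x => u x * (bump f2 t d x)%:C) a (c + 1).
  move=> at_ tc x; rewrite mulf_eq0 negb_or => /andP[_ h].
  have /(bump_supp f2s d0)/andP[? ?] : bump f2 t d x != 0.
    by apply: contra h => /eqP ->.
  by apply/andP; split; lra.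
pose I t := cLintegral (fun x => u x * (bump f2 t d x)%:C).
have hI : cLintegral (fun x => u x * (phi2 x)%:C) =
    (c - b)%:C * I a - (c - a)%:C * I b + (b - a)%:C * I c.
  have sBa := sB a (lexx _) ac'; have sBb := sB b ab' bc'; have sBc := sB c ac' (lexx _).
  rewrite (_ : (fun _ => _) = (fun x => (c - b)%:C * (u x * (bump f2 a d x)%:C) +
     ((- (c - a))%:C * (u x * (bump f2 b d x)%:C) + (b - a)%:C * (u x * (bump f2 c d x)%:C)))); last first.
    by apply/funext => x; rewrite /phi2; rewrite !rmorphD /= !rmorphM /=; ring.
  rewrite (stieltjes_lin _ (@stieltjes_leb R) ac1)//; last 2 first.
  - by apply: ccontinuousD; exact: ccontinuousZ.
  - by apply: supp_inD; exact: supp_inZ.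
  rewrite (stieltjes_lin _ (@stieltjes_leb R) ac1)//; last 2 first.
  - exact: ccontinuousZ.
  - exact: supp_inZ.
  by rewrite (stieltjesZ _ (@stieltjes_leb R) ac1)// rmorphN /I; ring.
pose v x := (hat a b c x)%:C * u x.
have cv : ccontinuous v by apply: ccontinuousM => //; exact: hat_continuous.
have sv : supp_in v a (c + 1) by apply: (@supp_in_sub _ _ a c) => //; [lra|exact: hatM_supp_in].
have hdiff : cmod (nu_integral mu lambda v - nu_integral mu lambda w) <= e / 2.
  have cvw : ccontinuous (fun x => -1 * w x + v x).
    by apply: ccontinuousD => //; exact: ccontinuousZ.
  have svw : supp_in (fun x => -1 * w x + v x) a (c + 1).
    by apply: supp_inD => //; exact: supp_inZ.
  have <- : nu_integral mu lambda (fun x => -1 * w x + v x) =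
      nu_integral mu lambda v - nu_integral mu lambda w.
    by rewrite (nu_lin _ _ _ ac1 cw cv sw sv); ring.
  have bnd x : cmod (-1 * w x + v x) <= q * d * U.
    have [xac|xac] := boolP (a <= x <= c + 1); last first.
      by rewrite (supp_in_out svw xac) cmod0; apply: mulr_ge0; [apply: mulr_ge0|]; exact: ltW.
    rewrite (_ : _ + _ = (hat a b c x - phi x)%:C * u x); last first.
      by rewrite /w /v rmorphB /=; ring.
    rewrite cmodM cmodR ler_pM ?cmod_ge0//; last first.
      by rewrite /U (le_trans (hy _ xac))// lerDl.
    have rd t : `|Num.max 0 (x - t) - rs t x| <= d.
      have h := @ramp_dist R ((x - t) / d).
      rewrite /rs sc distrC (_ : Num.max 0 (x - t) = d * Num.max 0 ((x - t) / d)).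
        by rewrite -mulrBr normrM gtr0_norm// ler_piMr// ltW.
      rewrite -[in RHS](mulr0 d^-1) [(x - t) / d]mulrC -maxr_pMr ?invr_ge0 ?ltW//.
      by rewrite mulrA divff ?mul1r// gt_eqF.
    have := rd a; have := rd b; have := rd c.
    rewrite /phi /hat /q !ler_norml.
    move: (Num.max 0 (x - a)) (Num.max 0 (x - b)) (Num.max 0 (x - c)) => ma mb mc.
    move: (rs a x) (rs b x) (rs c x) => ra rb rc.
    move=> /andP[h1 h2] /andP[h3 h4] /andP[h5 h6]; apply/andP; split; nra.
  rewrite (le_trans (hN _ _ _ _ ac1 cvw svw bnd))//.
  rewrite [leLHS](_ : _ = V * d); last by rewrite /V; ring.
  by rewrite mulrC -ler_pdivlMr.
rewrite -/v.
set T := _ + (b - a)%:C * u c.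
have hT : cmod (nu_integral mu lambda w - T) <= e / 2.
  rewrite hw hI /T.
  rewrite (_ : _ - _ = (c - b)%:C * (I a - u a) - (c - a)%:C * (I b - u b) + (b - a)%:C * (I c - u c));
    last by ring.
  rewrite (le_trans (cmodD _ _))//.
  have h := cmodB ((c - b)%:C * (I a - u a)) ((c - a)%:C * (I b - u b)).
  rewrite (le_trans (lerD h (lexx _)))// !cmodRM//.
  have ha := hda _ d0 da'; have hb := hdb _ d0 db'; have hc := hdc _ d0 dc'.
  rewrite -/(I a) in ha; rewrite -/(I b) in hb; rewrite -/(I c) in hc.
  apply: (@le_trans _ _ ((c - b) * (e / 2 / q) + (c - a) * (e / 2 / q) + (b - a) * (e / 2 / q))).
    by rewrite !lerD// ler_wpM2l.
  rewrite le_eqVlt; apply/orP; left; apply/eqP; rewrite /q; field.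
  by rewrite subr_eq0 gt_eqF//; lra.
rewrite (_ : _ - T = (nu_integral mu lambda v - nu_integral mu lambda w) +
  (nu_integral mu lambda w - T)); last by ring.
by rewrite (le_trans (cmodD _ _))//; lra.
Qed.

End three_point_formula.

(** * Boundedness and decay of eigenfunctions *)

Section square_integrable.
Context {R : realType}.
Implicit Types (u : R -> R[i]).

Let mu := @lebesgue_measure R.

Lemma continuous_cmod_sqr u : ccontinuous u -> continuous (fun x => cmod (u x) ^+ 2).
Proof.
move=> /continuous_cmod cc x.
rewrite (_ : (fun _ => _) = (fun x => cmod (u x) * cmod (u x))).
  exact: (cvgM (cc x) (cc x)).
by apply/funext => y; rewrite expr2.
Qed.

Lemma cL2_integrable u : ccontinuous u -> cL2 u ->
  mu.-integrable setT (fun x => (cmod (u x) ^+ 2)%:E).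
Proof.
move=> cu [_ _ fin]; apply/integrableP; split.
  apply/measurable_EFinP; apply: continuous_measurable_fun.
  exact: continuous_cmod_sqr.
have {}fin : ((\int[mu]_x (`|(cmod (u x))%:E| `^ 2)) `^ 2^-1 < +oo)%E.
  by move: fin; rewrite unlock.
have e2 x : (`|(cmod (u x))%:E| `^ 2 = `|(cmod (u x) ^+ 2)%:E|)%E.
  rewrite !abse_EFin poweR_EFin ger0_norm ?cmod_ge0// powR_mulrn ?cmod_ge0//.
  by rewrite ger0_norm// exprn_ge0 ?cmod_ge0.
rewrite ltey; apply/eqP => I; move: fin.
by under eq_integral do rewrite e2; rewrite I poweRyr ?invr_eq0 ?pnatr_eq0.
Qed.

Definition far (r : R) : set R := [set x | r < `|x|].

Lemma measurable_far r : measurable (far r).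
Proof.
rewrite (_ : far r = ~` [set` `[- r, r]]); first by apply: measurableC; exact: measurable_itv.
apply/seteqP; split => x; rewrite /far /= in_itv /= -ler_norml; first by move/lt_geF ->.
by move/negP; rewrite -ltNge.
Qed.

(** Dominated convergence to [0]. *)
Lemma tail_integral (g : R -> R) (e : R) : continuous g -> (forall x, 0 <= g x) ->
  mu.-integrable setT (fun x => (g x)%:E) -> 0 < e ->
  exists n : nat, (\int[mu]_(x in far n%:R) (g x)%:E < e%:E)%E.
Proof.
move=> cg g0 ig e0.
pose D (n : nat) := far n%:R.
have mD n : measurable (D n) by exact: measurable_far.
pose f_ n x := (((g \_ (D n)) x)%:E).
have mg : measurable_fun setT (g : measurableTypeR R -> measurableTypeR R).
  exact: continuous_measurable_fun.
have [] := @dominated_convergence _ _ _ mu setT measurableT f_ (cst 0%E) (fun x => (g x)%:E).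
- move=> n; apply/measurable_EFinP; apply/(measurable_restrictT _ (mD n)).
  exact: measurable_funTS.
- exact: measurable_cst.
- apply: aeW => x _; apply: cvg_near_cst; near=> n.
  rewrite /f_ patchE memNset// /D /far /=; apply/negP; rewrite -leNgt.
  by near: n; exact: nbhs_infty_ger.
- by [].
- apply: aeW => x n _; rewrite /f_ patchE lee_fin; case: ifP => _.
    by rewrite ger0_norm.
  by rewrite normr0.
move=> _ _; rewrite integral0 => /fine_cvgP[hf].
move=> /cvgr0Pnorm_lt/(_ _ e0) hs.
have [n [nf ns]] := filter_ex (filterI hf hs); exists n.
rewrite integral_mkcond (_ : (_ \_ _) = f_ n); last first.
  by apply/funext => x; rewrite /f_ !patchE; case: ifP.
move: nf ns => /= nf ns; rewrite -(fineK nf) lte_fin (le_lt_trans _ ns)//.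
exact: ler_norm.
Unshelve. all: by end_near. Qed.

End square_integrable.

Section a_priori_bounds.
Context {R : realType}.
Variables (u : R -> R[i]) (L : (R -> R[i]) -> R[i]) (N : R).
Hypotheses (cu : ccontinuous u) (N0 : 0 < N).
Hypothesis L_bound : forall v a b s, a <= b -> ccontinuous v -> supp_in v a b ->
  (forall x, cmod (v x) <= s) -> cmod (L v) <= N * (b - a + 1) * s.
Hypothesis L_hat : forall a b c, a < b -> b < c ->
  L (fun x => (hat a b c x)%:C * u x) =
  (c - b)%:C * u a - (c - a)%:C * u b + (b - a)%:C * u c.

Lemma hatM_bound (a b c S : R) (v : R -> R[i]) : a <= b -> b <= c -> 0 <= S ->
  ccontinuous v ->
  (forall x, a <= x <= c -> cmod (v x) <= S) ->
  cmod (L (fun x => (hat a b c x)%:C * v x)) <= N * (c - a + 1) * ((b - a) * (c - b) * S).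
Proof.
move=> ab bc S0 cv vS; apply: L_bound; first by lra.
- by apply: ccontinuousM => //; exact: hat_continuous.
- exact: hatM_supp_in.
move=> x; have [xac|xac] := boolP (a <= x <= c); last first.
  rewrite (supp_in_out (hatM_supp_in (u := v) ab bc) xac) cmod0.
  by rewrite mulr_ge0// mulr_ge0; lra.
have /andP[h0 h1] := hat_bounds x ab bc.
by rewrite cmodM cmodR ger0_norm// ler_pM ?cmod_ge0// vS.
Qed.

Let triple (a b c S : R) : a < b -> b < c -> c - a <= 1 ->
  (forall x, a <= x <= c -> cmod (u x) <= S) ->
  (c - b) * cmod (u b - u a) <= (b - a) * (2 * S) + 2 * N * ((b - a) * (c - b) * S) /\
  (b - a) * cmod (u c - u b) <= (c - b) * (2 * S) + 2 * N * ((b - a) * (c - b) * S).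
Proof.
move=> ab bc ca uS.
have S0 : 0 <= S by apply: le_trans (cmod_ge0 _) (uS a _); apply/andP; split; lra.
have h := hatM_bound (ltW ab) (ltW bc) S0 cu uS.
have h' : cmod (L (fun x => (hat a b c x)%:C * u x)) <= 2 * N * ((b - a) * (c - b) * S).
  apply: (le_trans h); apply: ler_wpM2r; last by rewrite mulrC ler_pM2r//; lra.
  by apply: mulr_ge0 => //; apply: mulr_ge0; lra.
move: h'; rewrite L_hat// => h'.
have ua : cmod (u a) <= S by apply: uS; apply/andP; split; lra.
have ub : cmod (u b) <= S by apply: uS; apply/andP; split; lra.
have uc : cmod (u c) <= S by apply: uS; apply/andP; split; lra.
set T := _ + _ in h'; split.
- rewrite -cmodRM; last by lra.
  rewrite (_ : _ * _ = (b - a)%:C * (u c - u b) - T); last first.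
    by rewrite /T !rmorphB /=; ring.
  rewrite (le_trans (cmodB _ _))// lerD// cmodRM; last by lra.
  by rewrite ler_wpM2l//; [lra|have := cmodB (u c) (u b); lra].
- rewrite -cmodRM; last by lra.
  rewrite (_ : _ * _ = (c - b)%:C * (u b - u a) + T); last first.
    by rewrite /T !rmorphB /=; ring.
  rewrite (le_trans (cmodD _ _))// lerD// cmodRM; last by lra.
  by rewrite ler_wpM2l//; [lra|have := cmodB (u b) (u a); lra].
Qed.

(** On a unit interval the second difference controls the difference quotient
    at every scale by its value at scale [1 / 2], hence by the supremum. *)
Lemma local_lipschitz (x S : R) : (forall y, x <= y <= x + 1 -> cmod (u y) <= S) ->
  forall a b, x <= a -> a <= b -> b <= x + 1 ->
  cmod (u b - u a) <= (4 + 2 * N) * S * (b - a).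
Proof.
move=> uS.
have S0 : 0 <= S by apply: le_trans (cmod_ge0 _) (uS x _); apply/andP; split; lra.
have left (a b : R) : x <= a -> a <= b -> b <= x + 1 / 2 ->
    cmod (u b - u a) <= (4 + 2 * N) * S * (b - a).
  move=> xa; rewrite le_eqVlt => /orP[/eqP <- _|ab bx]; first by rewrite !subrr cmod0 mulr0.
  have [|||h _] := @triple a b (x + 1) S ab; [lra|lra| |].
    by move=> y /andP[? ?]; apply: uS; apply/andP; split; lra.
  have c0 : 1 / 2 <= x + 1 - b by lra.
  have m0 := cmod_ge0 (u b - u a).
  have ba0 : 0 <= (b - a) * S by rewrite mulr_ge0//; lra.
  rewrite -(ler_pM2l (_ : 0 < x + 1 - b)); last by lra.
  apply: (le_trans h).
  rewrite [leRHS](_ : _ = (4 * (x + 1 - b)) * ((b - a) * S) + 2 * N * ((b - a) * (x + 1 - b) * S)); last by ring.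
  rewrite lerD2r (_ : (b - a) * (2 * S) = 2 * ((b - a) * S)); last by ring.
  by rewrite ler_wpM2r//; lra.
have right (a b : R) : x + 1 / 2 <= a -> a <= b -> b <= x + 1 ->
    cmod (u b - u a) <= (4 + 2 * N) * S * (b - a).
  move=> xa; rewrite le_eqVlt => /orP[/eqP <- _|ab bx]; first by rewrite !subrr cmod0 mulr0.
  have [||||_ h] := @triple x a b S; [lra|lra|lra| |].
    by move=> y /andP[? ?]; apply: uS; apply/andP; split; lra.
  have c0 : 1 / 2 <= a - x by lra.
  have ba0 : 0 <= (b - a) * S by rewrite mulr_ge0//; lra.
  rewrite -(ler_pM2l (_ : 0 < a - x)); last by lra.
  apply: (le_trans h).
  rewrite [leRHS](_ : _ = (4 * (a - x)) * ((b - a) * S) + 2 * N * ((a - x) * (b - a) * S)); last by ring.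
  rewrite lerD2r (_ : (b - a) * (2 * S) = 2 * ((b - a) * S)); last by ring.
  by rewrite ler_wpM2r//; lra.
move=> a b xa ab bx.
have [bm|bm] := leP b (x + 1 / 2); first exact: left.
have [am|am] := leP (x + 1 / 2) a; first exact: right.
have h1 := left a (x + 1 / 2) xa (ltW am) (lexx _).
have h2 := right (x + 1 / 2) b (lexx _) (ltW bm) bx.
rewrite (_ : u b - u a = (u b - u (x + 1 / 2)) + (u (x + 1 / 2) - u a)); last by ring.
rewrite (le_trans (cmodD _ _))//.
rewrite [leRHS](_ : _ = (4 + 2 * N) * S * (b - (x + 1 / 2)) + (4 + 2 * N) * S * (x + 1 / 2 - a)); last by ring.
exact: lerD.
Qed.

(** If [u] is large at some point of a unit interval then, by
    [local_lipschitz], it is at least half its supremum on a part of the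
    interval whose length [r] is fixed; the integral of the square over that
    part cannot be small, against the convergence of the tails. *)
Lemma vanish_at_infinity (e : R) : cL2 u -> 0 < e ->
  exists X : R, forall x, X <= `|x| -> cmod (u x) <= e.
Proof.
move=> u2 e0; have N1 := N0; have [l lE] : exists l : R, l = 4 + 2 * N by eexists.
have l0 : 4 < l by lra.
have [r r0 lr] : exists2 r : R, 0 < r & l * r = 1 / 2.
  exists (2 * l)^-1; first by rewrite invr_gt0; lra.
  by field; apply/eqP; lra.
have r1 : r <= 1 / 2.
  have : 4 * r <= l * r by apply: ler_wpM2r; lra.
  by lra.
have cc := continuous_cmod_sqr cu.
have g0 x : 0 <= cmod (u x) ^+ 2 by rewrite exprn_ge0 ?cmod_ge0.
have er : 0 < (e / 2) ^+ 2 * r by rewrite mulr_gt0// exprn_gt0//; lra.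
have [n hn] := tail_integral cc g0 (cL2_integrable cu u2) er.
exists (n%:R + 2) => x xn; rewrite leNgt; apply/negP => ex.
have xx1 : x <= x + 1 by lra.
have [y /andP[xy yx] ymax] := cmod_max cu xx1.
set S := cmod (u y) in ymax.
have eS : e < S by apply: lt_le_trans ex (ymax x _); apply/andP; split; lra.
have lip := local_lipschitz ymax; rewrite -lE in lip.
have [t [xt tx ty]] : exists t : R, [/\ x <= t, t + r <= x + 1 & forall z, t <= z <= t + r -> `|z - y| <= r].
  have [h|h] := leP y (x + 1 / 2).
    exists y; split; [lra|lra|] => z /andP[? ?]; rewrite ler_norml; apply/andP; split; lra.
  exists (y - r); split; [lra|lra|] => z /andP[? ?]; rewrite ler_norml; apply/andP; split; lra.
have big (z : R) : t <= z <= t + r -> e / 2 <= cmod (u z).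
  move=> zt; have /ty := zt; have /andP[tz zr] := zt => zy.
  have : cmod (u y - u z) <= l * S * r.
    have [yz|zy'] := leP y z.
      rewrite cmod_distC (le_trans (lip _ _ _ _ _))//; try lra.
      rewrite ler_wpM2l//; first by rewrite mulr_ge0//; lra.
      by move: zy; rewrite ger0_norm; lra.
    rewrite (le_trans (lip _ _ _ _ _))//; try lra.
    rewrite ler_wpM2l//; first by rewrite mulr_ge0//; lra.
    by move: zy; rewrite ler0_norm; lra.
  rewrite mulrAC lr => h; have := cmod_le_sub (u y) (u z); rewrite -/S; lra.
move: hn; rewrite ltNge => /negP; apply.
pose J : set R := [set` `[t, (t + r)]].
have mJ : measurable J by exact: measurable_itv.
have JD : J `<=` far n%:R.
  move=> z; rewrite /J /far /= in_itv /= => /andP[tz zr]; rewrite ltr_normr.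
  by move: xn; rewrite ler_normr => /orP[?|?]; apply/orP; [left|right]; lra.
have mg : measurable_fun setT (fun x => (cmod (u x) ^+ 2)%:E).
  by apply/measurable_EFinP; exact: continuous_measurable_fun.
apply: (@le_trans _ _ (\int[lebesgue_measure]_(x in J) (cmod (u x) ^+ 2)%:E)%E); last first.
  apply: ge0_subset_integral => //.
  - exact: measurable_far.
  - exact: measurable_funTS.
  - by move=> x0 _; rewrite lee_fin.
have lJ : (lebesgue_measure J = r%:E)%E.
  rewrite /J lebesgue_measure_itv /= lte_fin ifT; last by lra.
  by congr (_%:E); ring.
have -> : (((e / 2) ^+ 2 * r)%:E = \int[@lebesgue_measure R]_(x in J) (((e / 2) ^+ 2)%:E))%E.
  by have /= -> := integral_cst (@lebesgue_measure R) mJ ((e / 2) ^+ 2)%:E; rewrite lJ.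
apply: ge0_le_integral => //.
- by move=> z _; rewrite lee_fin exprn_ge0//; lra.
- exact: measurable_funTS.
- move=> z; rewrite /J /= in_itv /= => /big h; rewrite lee_fin.
  by rewrite lerXn2r// nnegrE ?cmod_ge0//; lra.
Qed.

(** Between points at distance more than [1] the bound of [u] itself gives the
    Lipschitz estimate. *)
Lemma global_bounds : cL2 u -> exists2 S : R, 0 < S &
  (forall x, cmod (u x) <= S) /\ lip u S.
Proof.
move=> u2; have [X hX] := vanish_at_infinity u2 ltr01.
have X0 : - (`|X| + 1) <= `|X| + 1 by have := normr_ge0 X; lra.
have [y _ ymax] := cmod_max cu X0.
pose S : R := cmod (u y) + 1.
have S0 : 0 < S by have := cmod_ge0 (u y); rewrite /S; lra.
have uS x : cmod (u x) <= S.
  have [/ymax|] := boolP (- (`|X| + 1) <= x <= `|X| + 1); first by rewrite /S; lra.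
  rewrite -ler_norml -ltNge => h.
  have : X <= `|x| by have := ler_norm X; lra.
  by move=> /hX; rewrite /S; have := cmod_ge0 (u y); lra.
have N1 := N0; have l0 : 0 < 4 + 2 * N by lra.
exists ((4 + 2 * N) * S); first exact: mulr_gt0.
split; first by move=> x; rewrite (le_trans (uS x))//; nra.
have aux (x y0 : R) : x <= y0 -> cmod (u y0 - u x) <= (4 + 2 * N) * S * (y0 - x).
  move=> xy; have [h|h] := leP y0 (x + 1).
    exact: (@local_lipschitz x S).
  have K4 : 4 * S <= (4 + 2 * N) * S by rewrite ler_pM2r//; lra.
  have : (4 + 2 * N) * S * 1 <= (4 + 2 * N) * S * (y0 - x) by apply: ler_wpM2l; lra.
  by have := cmodB (u y0) (u x); have := uS y0; have := uS x; lra.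
move=> x z; have [xz|zx] := leP x z.
  by rewrite cmod_distC ler0_norm ?opprB; [exact: aux|lra].
by rewrite ger0_norm; [apply: aux; exact: ltW|lra].
Qed.

End a_priori_bounds.

(** * The Gordon argument *)

Section exponential_scales.
Context {R : realType}.

Let expR_ge_exp8 (k : nat) (t : R) : k%:R <= t -> 8 ^+ k <= expR (3 * t).
Proof.
move=> kt.
have e1 : 2 <= expR 1 :> R by have := @expR_ge1Dx R 1; lra.
have e8 : 8 <= expR 3 :> R.
  have -> : 3 = 3%:R * 1 :> R by rewrite mulr1.
  rewrite expRM_natl; apply: le_trans (_ : 2 ^+ 3 <= _); first by rewrite -natrX.
  by apply: lerXn2r; rewrite // nnegrE// ltW// expR_gt0.
apply: (@le_trans _ _ (expR (3 * k%:R))); last by rewrite ler_expR; lra.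
rewrite [3 * _]mulrC expRM_natl; apply: lerXn2r => //; rewrite nnegrE ?expR_ge0//.
Qed.

(** A mesh that divides [p] exactly and is comparable to [expR (- (C1 * p))]. *)
Lemma exponential_mesh (r p C1 : R) : 0 < r -> 2 <= p -> r^-1 <= p -> 2 <= C1 ->
  exists (m : nat) (h : R), [/\ m%:R * h = p, 0 < h, h <= r,
    h * expR (C1 * p) <= 1 & expR (- (4 * C1 * p)) <= h ^+ 3].
Proof.
move=> r0 p2 pr C12; have p0 : 0 < p by lra.
pose E : R := expR (C1 * p).
have C1p : 2 * p <= C1 * p by apply: ler_wpM2r => //; exact: ltW.
have Ep : 8 <= E.
  have := @expR_ge_exp8 1 1 (lexx _); rewrite expr1 mulr1 => h8.
  by apply: (le_trans h8); rewrite ler_expR; lra.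
have E0 : 0 < E by lra.
pose m := (Num.truncn (p * E)).+1.
have pE0 : 0 <= p * E by rewrite mulr_ge0 ?ltW.
have m1 : p * E < m%:R by exact: truncnS_gt.
have m2 : m%:R <= p * E + 1.
  by rewrite /m -natr1 lerD2r; have /andP[] := truncn_itv pE0.
have m0 : 0 < m%:R :> R by rewrite ltr0n.
pose h : R := p / m%:R.
have h0 : 0 < h by rewrite divr_gt0.
have hE : h * E <= 1 by rewrite /h mulrAC ler_pdivrMr// mul1r ltW.
have Eh : 1 <= 2 * (h * E).
  rewrite /h mulrAC mulrA ler_pdivlMr// mul1r.
  have : 2 * 8 <= p * E by apply: ler_pM.
  lra.
exists m, h; split => //.
- by rewrite /h mulrC divfK// gt_eqF.
- have E1 : r^-1 <= E by apply: (le_trans pr); have := expR_ge1Dx (C1 * p); rewrite -/E; lra.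
  have : h / r <= 1 by apply: le_trans hE; rewrite ler_pM2l.
  by rewrite ler_pdivrMr// mul1r.
- rewrite (_ : 4 * C1 * p = 4%:R * (C1 * p)); last by rewrite mulrA.
  rewrite expRN expRM_natl -/E.
  have hE3 : 1 <= 8 * (h * E) ^+ 3.
    have : 1 ^+ 3 <= (2 * (h * E)) ^+ 3 by apply: lerXn2r; rewrite ?nnegrE//; lra.
    by rewrite expr1n exprMn -natrX.
  rewrite -div1r ler_pdivrMr ?exprn_gt0//.
  apply: (le_trans hE3); rewrite exprMn [E ^+ 4]exprS.
  rewrite (_ : h ^+ 3 * (E * E ^+ 3) = E * (h ^+ 3 * E ^+ 3)); last by ring.
  apply: ler_wpM2r => //; rewrite mulr_ge0 ?exprn_ge0//; exact: ltW.
Qed.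

(** [8 ^+ k] is the loss of [k] Gronwall steps of length [r], over a distance of
    at most [p]; the mesh makes up for it and for two more factors [p]. *)
Lemma exponential_gain (r p h : R) (k : nat) : 0 < r -> 0 < p -> 0 < h ->
  h * expR ((3 / r + 2) * p) <= 1 -> k%:R <= p / r -> 8 ^+ k * (h * p) * p <= 1.
Proof.
move=> r0 p0 h0 hE k1.
have g8 : 8 ^+ k <= expR (3 / r * p).
  apply: (le_trans (expR_ge_exp8 k1)); rewrite ler_expR le_eqVlt; apply/orP; left.
  by apply/eqP; ring.
have e2 : p <= expR p by have := expR_ge1Dx p; lra.
have EE : expR ((3 / r + 2) * p) = expR (3 / r * p) * expR p * expR p.
  by rewrite -!expRD mulrDl [2 * p]mulr_natl mulr2n addrA.
have p00 := ltW p0; have hp00 : 0 <= h * p by apply: mulr_ge0 => //; exact: ltW.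
have k00 : 0 <= 8 ^+ k :> R by exact: exprn_ge0.
have khp00 : 0 <= 8 ^+ k * (h * p) by exact: mulr_ge0.
apply: (le_trans _ hE); rewrite EE.
rewrite [leRHS](_ : _ = expR (3 / r * p) * (h * expR p) * expR p); last by ring.
by apply: ler_pM => //; apply: ler_pM => //; rewrite ler_pM2l.
Qed.

End exponential_scales.

Section gordon_argument.
Context {R : realType}.
Variables (u : R -> R[i]) (L : (R -> R[i]) -> R[i]) (N S : R).
Hypotheses (N0 : 0 < N) (S0 : 0 < S).
Hypotheses (uS : forall x, cmod (u x) <= S) (lu : lip u S).
Hypothesis L_lin : forall v w (z : R[i]) a b, a <= b ->
  ccontinuous v -> ccontinuous w -> supp_in v a b -> supp_in w a b ->
  L (fun x => z * v x + w x) = z * L v + L w.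
Hypothesis L_bound : forall v a b s, a <= b -> ccontinuous v -> supp_in v a b ->
  (forall x, cmod (v x) <= s) -> cmod (L v) <= N * (b - a + 1) * s.
Hypothesis L_hat : forall a b c, a < b -> b < c ->
  L (fun x => (hat a b c x)%:C * u x) =
  (c - b)%:C * u a - (c - a)%:C * u b + (b - a)%:C * u c.

Implicit Types (g v w : R -> R[i]) (a b c e h r p : R).

(** The second divided difference, times [(b - a) * (c - b) * (c - a)]. *)
Definition diff2 g a b c : R[i] := (c - b)%:C * g a - (c - a)%:C * g b + (b - a)%:C * g c.

(** Up to the error [e], the function [g] solves the same equation as [u] on
    [[al, be]]; the equation is stated without derivatives, in a form that is
    stable under weak perturbations of the measure. *)
Definition approx_sol g (al be e : R) := forall a b c, al <= a -> a < b -> b < c ->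
  c <= be -> c - a <= 2 ->
  cmod (diff2 g a b c - L (fun x => (hat a b c x)%:C * g x)) <= e * (c - a).

Let cu : ccontinuous u. Proof. exact: lip_ccontinuous lu. Qed.

Lemma approx_sol_self al be : approx_sol u al be 0.
Proof.
move=> a b c _ ab bc _ _.
by rewrite /diff2 L_hat// subrr cmod0 mul0r.
Qed.

Lemma approx_sol_lin g g' (z : R[i]) al be e e' :
  ccontinuous g -> ccontinuous g' ->
  approx_sol g al be e -> approx_sol g' al be e' ->
  approx_sol (fun x => z * g x + g' x) al be (cmod z * e + e').
Proof.
move=> cg cg' hg hg' a b c aa ab bc cb ca.
have ab' := ltW ab; have bc' := ltW bc; have ac' : a <= c by lra.
rewrite (_ : (fun x => (hat a b c x)%:C * (z * g x + g' x)) =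
  (fun x => z * ((hat a b c x)%:C * g x) + (hat a b c x)%:C * g' x)); last first.
  by apply/funext => x; ring.
rewrite (L_lin z ac'); last 4 first.
- by apply: ccontinuousM => //; exact: hat_continuous.
- by apply: ccontinuousM => //; exact: hat_continuous.
- exact: hatM_supp_in.
- exact: hatM_supp_in.
rewrite (_ : _ - _ = z * (diff2 g a b c - L (fun x => (hat a b c x)%:C * g x)) +
   (diff2 g' a b c - L (fun x => (hat a b c x)%:C * g' x))); last first.
  by rewrite /diff2; ring.
rewrite (le_trans (cmodD _ _))// mulrDl lerD//; last exact: hg'.
by rewrite cmodM -mulrA ler_wpM2l ?cmod_ge0//; exact: hg.
Qed.

Let hatM_lip g a b c : (forall x, cmod (g x) <= S) -> lip g S ->
  a < b -> b < c -> c - a <= 2 ->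
  lip (fun x => (hat a b c x)%:C * g x) (4 * S * (c - a)).
Proof.
move=> gS lg ab bc ca x y; have S1 := S0.
have ab' := ltW ab; have bc' := ltW bc.
rewrite (_ : _ - _ = (hat a b c x - hat a b c y)%:C * g x + (hat a b c y)%:C * (g x - g y)); last first.
  by rewrite rmorphB /=; ring.
have h1 := hat_lip x y ab' bc'; have /andP[h2 h3] := hat_bounds y ab' bc'.
rewrite (le_trans (cmodD _ _))// !cmodM !cmodR (ger0_norm h2).
have d0 := normr_ge0 (x - y).
have k1 : `|hat a b c x - hat a b c y| * cmod (g x) <= 2 * (c - a) * `|x - y| * S.
  by apply: ler_pM; rewrite ?cmod_ge0.
have h4 : hat a b c y <= 2 * (c - a).
  apply: (le_trans h3); apply: ler_pM; lra.
have k2 : hat a b c y * cmod (g x - g y) <= 2 * (c - a) * (S * `|x - y|).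
  by apply: ler_pM; rewrite ?cmod_ge0.
lra.
Qed.

Section translates.
Variables (p eps : R).
Hypothesis close : forall v a b K, a <= b -> 0 < K -> lip v K -> supp_in v a b ->
  - p <= a -> b <= p -> b - a <= 2 ->
  cmod (L v - L (fun x => v (x - p))) <= K * eps.

Lemma hat_shift a b c x : hat (a + p) (b + p) (c + p) (x + p) = hat a b c x.
Proof.
rewrite /hat (_ : x + p - (a + p) = x - a); last by ring.
rewrite (_ : x + p - (b + p) = x - b); last by ring.
rewrite (_ : x + p - (c + p) = x - c); last by ring.
ring.
Qed.

Let diff2_shift a b c : diff2 u (a + p) (b + p) (c + p) = diff2 (fun x => u (x + p)) a b c.
Proof.
rewrite /diff2 (_ : c + p - (b + p) = c - b); last by ring.
rewrite (_ : c + p - (a + p) = c - a); last by ring.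
by rewrite (_ : b + p - (a + p) = b - a); last by ring.
Qed.

(** The translate solves the equation of the translated measure exactly, and
    replacing the measure by the original one costs the weak distance times the
    Lipschitz constant of hat times solution. *)
Lemma approx_sol_right : approx_sol (fun x => u (x + p)) (- p) p (4 * S * eps).
Proof.
move=> a b c pa ab bc cp ca; have S1 := S0.
pose v x := (hat a b c x)%:C * u (x + p).
have ab' := ltW ab; have bc' := ltW bc; have ac : a <= c by lra.
have lf : lip (fun x => u (x + p)) S.
  move=> x y; apply: le_trans (lu _ _) _.
  by rewrite (_ : x + p - (y + p) = x - y)//; ring.
have lv : lip v (4 * S * (c - a)) by apply: hatM_lip.
have K0 : 0 < 4 * S * (c - a) by rewrite !mulr_gt0//; lra.
have := close ac K0 lv (hatM_supp_in ab' bc') pa cp ca.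
rewrite (_ : L (fun x => v (x - p)) = diff2 (fun x => u (x + p)) a b c).
  by rewrite cmod_distC (_ : 4 * S * (c - a) * eps = 4 * S * eps * (c - a))//; ring.
rewrite -diff2_shift /diff2 -L_hat; [|lra|lra]; congr (L _).
by apply/funext => x; rewrite /v -hat_shift subrK.
Qed.

Lemma approx_sol_left : approx_sol (fun x => u (x - p)) 0 (2 * p) (4 * S * eps).
Proof.
move=> a b c pa ab bc cp ca; have S1 := S0.
pose v x := (hat (a - p) (b - p) (c - p) x)%:C * u x.
have ab' : a - p < b - p by lra.
have bc' : b - p < c - p by lra.
have ac : a - p <= c - p by lra.
have lv : lip v (4 * S * (c - p - (a - p))) by apply: hatM_lip => //; lra.
have K0 : 0 < 4 * S * (c - p - (a - p)) by rewrite !mulr_gt0//; lra.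
have := close ac K0 lv (hatM_supp_in (ltW ab') (ltW bc')).
rewrite {1}/v L_hat//.
rewrite (_ : (fun x => v (x - p)) = (fun x => (hat a b c x)%:C * u (x - p))); last first.
  by apply/funext => x; rewrite /v -hat_shift !subrK.
rewrite (_ : c - p - (a - p) = c - a); last by ring.
rewrite (_ : c - p - (b - p) = c - b); last by ring.
rewrite (_ : b - p - (a - p) = b - a); last by ring.
move=> h; rewrite (_ : 4 * S * eps * (c - a) = 4 * S * (c - a) * eps); last by ring.
by apply: h; lra.
Qed.

End translates.

Section gronwall.
Variables (g : R -> R[i]) (al be e r : R).
Hypotheses (cg : ccontinuous g) (sol : approx_sol g al be e) (e0 : 0 <= e).
Hypotheses (r0 : 0 < r) (r2 : r <= 1 / 2) (Nr : 2 * N * r <= 1 / 2).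

Let solve a b c s : al <= a -> a < b -> b < c -> c <= be -> c - a <= 1 -> 0 <= s ->
  (forall x, a <= x <= c -> cmod (g x) <= s) ->
  (b - a) * cmod (g c) <= (c - b) * cmod (g a) + (c - a) * cmod (g b) +
    2 * N * (c - b) * ((b - a) * s) + e * (c - a).
Proof.
move=> aa ab bc cb ca s0 gs; have N2 := N0.
have h1 : cmod (diff2 g a b c - L (fun x => (hat a b c x)%:C * g x)) <= e * (c - a).
  by apply: sol => //; lra.
have h2 := hatM_bound L_bound (ltW ab) (ltW bc) s0 cg gs.
have h3 : cmod (L (fun x => (hat a b c x)%:C * g x)) <= 2 * N * (c - b) * ((b - a) * s).
  apply: (le_trans h2).
  rewrite (_ : 2 * N * (c - b) * ((b - a) * s) = 2 * N * ((b - a) * (c - b) * s)); last by ring.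
  apply: ler_wpM2r; last by rewrite mulrC ler_pM2r//; lra.
  by apply: mulr_ge0 => //; apply: mulr_ge0; lra.
rewrite -cmodRM; last by lra.
set l := L _ in h1 h3.
rewrite (_ : (b - a)%:C * g c = (diff2 g a b c - l) + l - ((c - b)%:C * g a - (c - a)%:C * g b)); last first.
  by rewrite /diff2; ring.
rewrite (le_trans (cmodB _ _))//.
have h4 := cmodD (diff2 g a b c - l) l.
have h5 := cmodB ((c - b)%:C * g a) ((c - a)%:C * g b).
move: h5; rewrite !cmodRM; [|lra|lra]; lra.
Qed.

(** The equation on [X < X + r < y], with [r] so small that the measure term
    absorbs at most half of the supremum of [g] over both intervals. Taking [r]
    as mesh avoids derivatives, over which weak perturbations give no pointwise
    control. *)
Lemma gronwall_step X s : al <= X ->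
  (forall x, X <= x <= X + r -> cmod (g x) <= s) ->
  forall x, X + r <= x -> x <= X + 2 * r -> x <= be -> cmod (g x) <= 7 * s + 4 * e.
Proof.
move=> aX gs x Xx xX xb; have N2 := N0; have r0' := r0; have r2' := r2; have e0' := e0.
have Nr' := Nr.
have s0 : 0 <= s by apply: le_trans (cmod_ge0 _) (gs X _); apply/andP; split; lra.
have [y /andP[Xy yx] ymax] := cmod_max cg Xx.
set M := cmod (g y) in ymax.
have M0 : 0 <= M by exact: cmod_ge0.
have gx : cmod (g x) <= M by apply: ymax; rewrite Xx lexx.
apply: (le_trans gx).
have [yX|yX] := leP y (X + r).
  have : M <= s by apply: gs; apply/andP; split; lra.
  lra.
have XXr : X < X + r by lra.
have bnd t : X <= t <= y -> cmod (g t) <= s + M.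
  move=> /andP[Xt ty]; have [tX|tX] := leP t (X + r).
    have : cmod (g t) <= s by apply: gs; rewrite Xt.
    lra.
  have : cmod (g t) <= M by apply: ymax; apply/andP; split; lra.
  lra.
have sM : 0 <= s + M by lra.
have := @solve X (X + r) y (s + M) aX XXr yX _ _ sM bnd.
rewrite (_ : X + r - X = r); last by ring.
move=> h; have {}h := h ltac:(lra) ltac:(lra).
have gX : cmod (g X) <= s by apply: gs; apply/andP; split; lra.
have gXr : cmod (g (X + r)) <= s by apply: gs; apply/andP; split; lra.
have c1 : (y - (X + r)) * cmod (g X) <= r * s by apply: ler_pM; rewrite ?cmod_ge0//; lra.
have c2 : (y - X) * cmod (g (X + r)) <= 2 * r * s by apply: ler_pM; rewrite ?cmod_ge0//; lra.
have c3 : 2 * N * (y - (X + r)) * (r * (s + M)) <= 1 / 2 * (r * (s + M)).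
  apply: ler_wpM2r; first by apply: mulr_ge0 => //; exact: ltW.
  apply: le_trans Nr'; apply: ler_wpM2l; lra.
have c4 : e * (y - X) <= e * (2 * r) by apply: ler_wpM2l; lra.
rewrite -/M in h.
suff : r * M <= r * (7 * s + 4 * e) by rewrite ler_pM2l.
lra.
Qed.

Lemma gronwall B : (forall x, al <= x <= al + r -> cmod (g x) <= B) ->
  forall (k : nat) x, al <= x -> x <= be -> x <= al + k.+1%:R * r ->
  cmod (g x) + e <= 8 ^+ k * (B + e).
Proof.
move=> gB; have r0' := r0; have e0' := e0.
have B0 : 0 <= B by apply: le_trans (cmod_ge0 _) (gB al _); apply/andP; split; lra.
elim=> [|k ih] x ax xb xk.
  by rewrite expr0 mul1r lerD2r; apply: gB; rewrite ax; lra.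
have P0 : 0 <= 8 ^+ k * (B + e) by rewrite mulr_ge0 ?exprn_ge0//; lra.
have P8 : 8 ^+ k.+1 * (B + e) = 8 * (8 ^+ k * (B + e)) by rewrite exprS mulrA.
rewrite P8.
have [xk'|xk'] := leP x (al + k.+1%:R * r).
  by have := ih _ ax xb xk'; lra.
pose X := al + k%:R * r.
have k0 : 0 <= k%:R * r by rewrite mulr_ge0 ?ler0n// ltW.
have Xr : X + r = al + k.+1%:R * r by rewrite /X -natr1; ring.
have X2r : X + 2 * r = al + k.+2%:R * r by rewrite /X -!natr1; ring.
have aX : al <= X by rewrite /X; lra.
have gs y : X <= y <= X + r -> cmod (g y) <= 8 ^+ k * (B + e) - e.
  rewrite Xr => /andP[Xy yX].
  have := ih y; have : al <= y by lra.
  by move=> -> /(_ isT) h; have := h ltac:(lra) yX; lra.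
have := @gronwall_step X _ aX gs x; rewrite Xr X2r => h.
have {}h := h (ltW xk') xk xb.
lra.
Qed.

(** Smallness of [g] at the two close points [al] and [al + h], that is, of the
    value and of the slope, starts the induction of [gronwall]; the error [e] is
    divided by [h]. *)
Lemma gronwall_start h (d l : R) : 0 < h -> h <= r -> al + r <= be -> 0 <= d ->
  lip g l -> g al = 0 -> cmod (g (al + h)) <= d * h ->
  forall x, al <= x <= al + r -> cmod (g x) <= l * h + d + e / h.
Proof.
move=> h0 hr ab d0 lg ga gh x /andP[ax xa]; have N2 := N0; have r0' := r0.
have r2' := r2; have e0' := e0; have Nr' := Nr.
have l0 : 0 <= l by have := le_trans (cmod_ge0 _) (lg 0 1); rewrite sub0r normrN1 mulr1.
have aar : al <= al + r by lra.
have [y /andP[ay yr] ymax] := cmod_max cg aar.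
set M := cmod (g y) in ymax.
have M0 : 0 <= M by exact: cmod_ge0.
have gx : cmod (g x) <= M by apply: ymax; rewrite ax.
apply: (le_trans gx).
have eh : 0 <= e / h by rewrite divr_ge0// ltW.
have lh : 0 <= l * h by rewrite mulr_ge0// ltW.
have [yh|yh] := leP y (al + h).
  have := lg y al; rewrite ga subr0 -/M ger0_norm; last by lra.
  have : l * (y - al) <= l * h by apply: ler_wpM2l; lra.
  lra.
have aah : al < al + h by lra.
have bnd t : al <= t <= y -> cmod (g t) <= M.
  by move=> /andP[? ?]; apply: ymax; apply/andP; split; lra.
have := @solve al (al + h) y M (lexx _) aah yh _ _ M0 bnd.
rewrite (_ : al + h - al = h); last by ring.
rewrite ga cmod0 mulr0 add0r -/M.
move=> k; have {}k := k ltac:(lra) ltac:(lra).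
have c2 : (y - al) * cmod (g (al + h)) <= 1 / 2 * (d * h).
  by apply: ler_pM; rewrite ?cmod_ge0//; lra.
have c3 : 2 * N * (y - (al + h)) * (h * M) <= 1 / 2 * (h * M).
  apply: ler_wpM2r; first by apply: mulr_ge0 => //; exact: ltW.
  apply: le_trans Nr'; apply: ler_wpM2l; lra.
have c4 : e * (y - al) <= e * (1 / 2) by apply: ler_wpM2l; lra.
have eE : e = h * (e / h) by rewrite mulrC divfK// gt_eqF.
have : h * M <= h * (d + e / h) by rewrite mulrDr -eE; lra.
rewrite ler_pM2l//; lra.
Qed.

End gronwall.


Let L_scale v (z : R[i]) a b : a <= b -> ccontinuous v -> supp_in v a b ->
  L (fun x => z * v x) = z * L v.
Proof.
move=> ab; apply: functional_scale => v' w y cv cw sv sw.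
exact: L_lin ab cv cw sv sw.
Qed.

Section wronskian.
Variables (v w : R -> R[i]) (al be e h : R).
Hypotheses (vS : forall x, cmod (v x) <= S) (lv : lip v S).
Hypotheses (wS : forall x, cmod (w x) <= S) (lw : lip w S).
Hypotheses (solv : approx_sol v al be 0) (solw : approx_sol w al be e).
Hypotheses (h0 : 0 < h) (h1 : h <= 1).

Let pt (k : nat) : R := al + k%:R * h.

Let D k := v (pt k) * w (pt k.+1) - v (pt k.+1) * w (pt k).

Let pt_S k : pt k.+1 = pt k + h. Proof. by rewrite /pt -natr1; ring. Qed.

Let pt_le k l : (k <= l)%N -> pt k <= pt l.
Proof. by move=> kl; rewrite lerD2l ler_wpM2r ?ler_nat// ltW. Qed.

Let phi k x := (hat (pt k) (pt k.+1) (pt k.+2) x)%:C *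
  (v (pt k.+1) * w x - w (pt k.+1) * v x).

Let Phi n x := \sum_(0 <= k < n) phi k x.

Let cv : ccontinuous v. Proof. exact: lip_ccontinuous lv. Qed.
Let cw : ccontinuous w. Proof. exact: lip_ccontinuous lw. Qed.

Let ptlt k : pt k < pt k.+1. Proof. by rewrite pt_S ltrDl. Qed.

Let cphi k : ccontinuous (phi k).
Proof.
apply: ccontinuousM; first by apply: hat_continuous; exact: ltW.
by apply: ccontinuousB; exact: ccontinuousZ.
Qed.

Let phi_supp k : supp_in (phi k) (pt k) (pt k.+2).
Proof. by apply: hatM_supp_in; exact: ltW. Qed.

Let cPhi n : ccontinuous (Phi n).
Proof. exact: ccontinuous_sum. Qed.

Let Phi_supp n : supp_in (Phi n) al (pt n.+1).
Proof.
move=> x; apply: contraNT => xn.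
rewrite /Phi big_nat_cond big1// => k /andP[/andP[_ kn] _].
apply: (supp_in_out (@phi_supp k)); apply: contra xn => /andP[kx xk].
have a0 : al <= pt k by have := @pt_le 0 k (leq0n k); rewrite /pt mul0r addr0.
have := @pt_le k.+2 n.+1 kn => k2.
by apply/andP; split; lra.
Qed.

(** In terms of positive parts the sum telescopes. Thus summing over the
    grid does not lose the factor [h] that an estimate of each term would. *)
Let hat_sum n x : \sum_(0 <= k < n) hat (pt k) (pt k.+1) (pt k.+2) x <= h ^+ 2.
Proof.
pose rr k := Num.max 0 (x - pt k).
have -> : \sum_(0 <= k < n) hat (pt k) (pt k.+1) (pt k.+2) x =
    h * ((rr 0 - rr 1) - (rr n - rr n.+1)).
  elim: n => [|n ih]; first by rewrite big_nil subrr mulr0.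
  rewrite big_nat_recr//= ih /hat -!/(rr _) !pt_S; ring.
rewrite expr2 ler_pM2l//.
have aux k : 0 <= rr k - rr k.+1 <= h.
  rewrite /rr pt_S; have h0' := h0.
  by case: (leP 0 (x - pt k)) => ?; case: (leP 0 (x - (pt k + h))) => ?;
    apply/andP; split; lra.
have /andP[_ ?] := aux 0; have /andP[? _] := aux n; lra.
Qed.

Let phi_le k x : cmod (phi k x) <= hat (pt k) (pt k.+1) (pt k.+2) x * (2 * S * S * h).
Proof.
have ab := ltW (ptlt k); have bc := ltW (ptlt k.+1).
have /andP[hh _] := hat_bounds x ab bc.
rewrite /phi cmodM cmodR ger0_norm//.
have [->|hx] := eqVneq (hat (pt k) (pt k.+1) (pt k.+2) x) 0; first by rewrite !mul0r.
have /andP[kx xk] := hat_supp ab bc hx.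
have xd : `|x - pt k.+1| <= h.
  by rewrite ler_norml !pt_S in xk *; apply/andP; split; lra.
apply: ler_wpM2l => //.
rewrite (_ : _ - _ = v (pt k.+1) * (w x - w (pt k.+1)) - w (pt k.+1) * (v x - v (pt k.+1)));
  last by ring.
rewrite (le_trans (cmodB _ _))// !cmodM.
have S1 := S0.
have Sh : S * `|x - pt k.+1| <= S * h by rewrite ler_pM2l.
have k1 : cmod (v (pt k.+1)) * cmod (w x - w (pt k.+1)) <= S * (S * h).
  by apply: ler_pM; rewrite ?cmod_ge0// (le_trans (lw _ _)).
have k2 : cmod (w (pt k.+1)) * cmod (v x - v (pt k.+1)) <= S * (S * h).
  by apply: ler_pM; rewrite ?cmod_ge0// (le_trans (lv _ _)).
lra.
Qed.

Let Phi_le n x : cmod (Phi n x) <= h ^+ 2 * (2 * S * S * h).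
Proof.
rewrite (le_trans (cmod_sum _ _ _))//.
apply: (@le_trans _ _ (\sum_(0 <= k < n) hat (pt k) (pt k.+1) (pt k.+2) x * (2 * S * S * h))).
  by apply: ler_sum => k _; exact: phi_le.
rewrite -mulr_suml; apply: ler_wpM2r; last exact: hat_sum.
by rewrite !mulr_ge0//; exact: ltW.
Qed.

Let wronskian_sum n : pt n.+1 <= be ->
  cmod (h%:C * (D n - D 0) - L (Phi n)) <= n%:R * (S * (e * (2 * h))).
Proof.
elim: n => [|n ih] nbe.
  rewrite subrr mulr0 mul0r sub0r cmodN.
  have -> : Phi 0 = (fun x => 0 * v x * 0).
    by apply/funext => x; rewrite /Phi big_nil mulr0.
  rewrite (_ : (fun _ => _) = (fun x => 0 * Phi 0 x)); last first.
    by apply/funext => x; rewrite mulr0 mul0r.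
  have a1 : al <= pt 1 by have := @pt_le 0 1 isT; rewrite {1}/pt mul0r addr0.
  by rewrite (L_scale _ a1 (@cPhi 0) (@Phi_supp 0)) mul0r cmod0.
have h0' := h0; have h1' := h1; have S1 := S0.
have nbe' : pt n.+1 <= be by apply: le_trans nbe; exact: ltW.
have {}ih := ih nbe'.
have a1 : al <= pt n.+2.
  by have := @pt_le 0 n.+2 isT; rewrite {1}/pt mul0r addr0.
have an : al <= pt n by have := @pt_le 0 n (leq0n n); rewrite {1}/pt mul0r addr0.
have ab := ptlt n; have bc := ptlt n.+1.
have ab' := ltW ab; have bc' := ltW bc.
have ac : pt n <= pt n.+2 by lra.
have sPhi : supp_in (Phi n) al (pt n.+2).
  by apply: (@supp_in_sub _ _ al (pt n.+1)) => //.
have sphi : supp_in (phi n) al (pt n.+2).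
  by apply: (@supp_in_sub _ _ (pt n) (pt n.+2)) => //.
have LS : L (Phi n.+1) = L (phi n) + L (Phi n).
  rewrite -[L (phi n)]mul1r -(L_lin 1 a1 (@cphi n) (@cPhi n) sphi sPhi); congr (L _).
  by apply/funext => x; rewrite /Phi big_nat_recr//= mul1r addrC.
pose H := hat (pt n) (pt n.+1) (pt n.+2).
have cHw : ccontinuous (fun x => (H x)%:C * w x) by apply: ccontinuousM => //; exact: hat_continuous.
have cHv : ccontinuous (fun x => (H x)%:C * v x) by apply: ccontinuousM => //; exact: hat_continuous.
have sHw : supp_in (fun x => (H x)%:C * w x) (pt n) (pt n.+2) by exact: hatM_supp_in.
have sHv : supp_in (fun x => (H x)%:C * v x) (pt n) (pt n.+2) by exact: hatM_supp_in.
have Lphi : L (phi n) = v (pt n.+1) * L (fun x => (H x)%:C * w x) -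
    w (pt n.+1) * L (fun x => (H x)%:C * v x).
  rewrite -mulNr -(L_scale _ ac cHv sHv).
  rewrite -(L_lin _ ac cHw (ccontinuousZ _ cHv) sHw (supp_inZ sHv)); congr (L _).
  by apply/funext => x; rewrite /phi -/H; ring.
have d2 g : diff2 g (pt n) (pt n.+1) (pt n.+2) = h%:C * (g (pt n) - 2 * g (pt n.+1) + g (pt n.+2)).
  rewrite /diff2 (_ : pt n.+2 - pt n.+1 = h); last by rewrite (pt_S n.+1); ring.
  rewrite (_ : pt n.+2 - pt n = h + h); last by rewrite (pt_S n.+1) (pt_S n); ring.
  rewrite (_ : pt n.+1 - pt n = h); last by rewrite (pt_S n); ring.
  by rewrite rmorphD /=; ring.
have ca : pt n.+2 - pt n = 2 * h by rewrite (pt_S n.+1) (pt_S n); ring.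
have ca2 : pt n.+2 - pt n <= 2 by rewrite ca; lra.
have ew := solw an ab bc nbe ca2; have ev := solv an ab bc nbe ca2.
rewrite ca d2 in ew; rewrite mul0r d2 in ev.
set lw' := L _ in ew; set lv' := L _ in ev.
rewrite LS Lphi -/lw' -/lv'.
rewrite (_ : _ - _ = (h%:C * (D n - D 0) - L (Phi n)) +
   (v (pt n.+1) * (h%:C * (w (pt n) - 2 * w (pt n.+1) + w (pt n.+2)) - lw') -
    w (pt n.+1) * (h%:C * (v (pt n) - 2 * v (pt n.+1) + v (pt n.+2)) - lv'))); last first.
  by rewrite /D; ring.
rewrite (le_trans (cmodD _ _))// -[n.+1%:R]natr1 [leRHS]mulrDl mul1r lerD//.
rewrite (le_trans (cmodB _ _))// !cmodM.
have ev0 : cmod (h%:C * (v (pt n) - 2 * v (pt n.+1) + v (pt n.+2)) - lv') = 0.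
  by apply/le_anti; rewrite ev cmod_ge0.
rewrite ev0 mulr0 addr0; apply: ler_pM; rewrite ?cmod_ge0//.
Qed.

(** The Wronskian [v w' - v' w] of two solutions of the same equation is
    constant, and [D n / h] approximates it at [pt n]. The increments of [h * D]
    pair the measure with the functions [phi k]; in these the products [v w]
    cancel up to an error of order [h], because [v] and [w] are Lipschitz. *)
Lemma wronskian n : pt n.+1 <= be ->
  cmod (D n - D 0) <= 2 * N * S ^+ 2 * (n.+1%:R * h + 1) * h ^+ 2 + 2 * S * n%:R * e.
Proof.
move=> nbe; have N2 := N0; have S1 := S0; have h0' := h0.
have a1 : al <= pt n.+1 by have := @pt_le 0 n.+1 isT; rewrite {1}/pt mul0r addr0.
have k1 := wronskian_sum nbe.
have k2 := L_bound a1 (@cPhi n) (@Phi_supp n) (@Phi_le n).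
rewrite -(ler_pM2l h0).
have -> : h * cmod (D n - D 0) = cmod (h%:C * (D n - D 0)) by rewrite cmodRM// ltW.
apply: (le_trans (cmod_le_sub _ (L (Phi n)))).
apply: (le_trans (lerD k2 k1)).
rewrite (_ : pt n.+1 - al = n.+1%:R * h); last by rewrite /pt; ring.
by rewrite le_eqVlt; apply/orP; left; apply/eqP; ring.
Qed.

End wronskian.

(** At the maximum [t] of the modulus of [u] over the added interval, the
    three-point equation with two points in the unit interval bounds the modulus
    by half of itself. *)
Let vanish_extend x r : 0 < r -> r <= 1 -> 2 * N * r <= 1 / 2 ->
  (forall y, x <= y <= x + 1 -> u y = 0) ->
  forall y, x - r <= y <= x + 1 + r -> u y = 0.
Proof.
move=> r0 r1 Nr ux; have N2 := N0.
have right y : x + 1 <= y -> y <= x + 1 + r -> u y = 0.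
  move=> xy yr; have x1 : x + 1 <= x + 1 + r by lra.
  have [t /andP[t1 t2] tmax] := cmod_max cu x1.
  suff ut : cmod (u t) = 0.
    by apply: cmod_eq0; apply/le_anti; rewrite cmod_ge0 andbT -ut tmax// xy.
  have [tx|tx] := leP t (x + 1); first by rewrite ux ?cmod0//; apply/andP; split; lra.
  have x01 : x < x + 1 by lra.
  have bnd s : x <= s <= t -> cmod (u s) <= cmod (u t).
    move=> /andP[xs st]; have [sx|sx] := leP s (x + 1).
      by rewrite ux ?cmod0 ?cmod_ge0// xs.
    by apply: tmax; apply/andP; split; lra.
  have := hatM_bound L_bound (ltW x01) (ltW tx) (cmod_ge0 (u t)) cu bnd.
  rewrite L_hat// (ux x) ?lexx ?(ltW x01)// (ux (x + 1)) ?lexx ?(ltW x01)//.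
  rewrite !mulr0 subr0 add0r (_ : x + 1 - x = 1); last by ring.
  rewrite mul1r mul1r => k; have m0 := cmod_ge0 (u t).
  have k1 : N * (t - x + 1) * ((t - (x + 1)) * cmod (u t)) <= N * 3 * (r * cmod (u t)).
    apply: ler_pM.
    - by apply: mulr_ge0; lra.
    - by apply: mulr_ge0; lra.
    - by rewrite ler_pM2l//; lra.
    - by apply: ler_wpM2r; lra.
  have k2 : 2 * N * r * cmod (u t) <= 1 / 2 * cmod (u t) by apply: ler_wpM2r.
  lra.
have left y : x - r <= y -> y <= x -> u y = 0.
  move=> xy yr; have x1 : x - r <= x by lra.
  have [t /andP[t1 t2] tmax] := cmod_max cu x1.
  suff ut : cmod (u t) = 0.
    by apply: cmod_eq0; apply/le_anti; rewrite cmod_ge0 andbT -ut tmax// xy.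
  have [tx|tx] := leP x t; first by rewrite ux ?cmod0//; apply/andP; split; lra.
  have x01 : x < x + 1 by lra.
  have bnd s : t <= s <= x + 1 -> cmod (u s) <= cmod (u t).
    move=> /andP[xs st]; have [sx|sx] := leP x s.
      by rewrite ux ?cmod0 ?cmod_ge0// sx.
    by apply: tmax; apply/andP; split; lra.
  have := hatM_bound L_bound (ltW tx) (ltW x01) (cmod_ge0 (u t)) cu bnd.
  rewrite L_hat// (ux x) ?lexx ?(ltW x01)// (ux (x + 1)) ?lexx ?(ltW x01)//.
  rewrite !mulr0 subr0 addr0 (_ : x + 1 - x = 1); last by ring.
  rewrite mul1r mulr1 => k; have m0 := cmod_ge0 (u t).
  have k1 : N * (x + 1 - t + 1) * ((x - t) * cmod (u t)) <= N * 3 * (r * cmod (u t)).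
    apply: ler_pM.
    - by apply: mulr_ge0; lra.
    - by apply: mulr_ge0; lra.
    - by rewrite ler_pM2l//; lra.
    - by apply: ler_wpM2r; lra.
  have k2 : 2 * N * r * cmod (u t) <= 1 / 2 * cmod (u t) by apply: ler_wpM2r.
  lra.
move=> y /andP[xy yx].
have [y1|y1] := leP y x; first exact: left.
have [y2|y2] := leP (x + 1) y; first exact: right.
by apply: ux; apply/andP; split; lra.
Qed.

(** Repeated extension by the fixed amount [r] reaches every point. *)
Lemma unique_continuation x : (forall y, x <= y <= x + 1 -> u y = 0) ->
  forall y, u y = 0.
Proof.
move=> ux; have N2 := N0; pose r := (4 * N + 4)^-1.
have r0 : 0 < r by rewrite invr_gt0; lra.
have rE : (4 * N + 4) * r = 1 by rewrite mulfV// gt_eqF//; lra.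
have Nr : 0 <= N * r by rewrite mulr_ge0// ltW.
have r1 : r <= 1 by lra.
have Nr2 : 2 * N * r <= 1 / 2 by lra.
have ext (k : nat) : forall y, x - k%:R * r <= y <= x + 1 + k%:R * r -> u y = 0.
  elim: k => [|k ih] y; first by rewrite mul0r subr0 addr0; exact: ux.
  have kr : 0 <= k%:R * r by rewrite mulr_ge0 ?ler0n// ltW.
  rewrite -natr1 mulrDl mul1r => /andP[y1 y2].
  have left_ext := @vanish_extend (x - k%:R * r) r r0 r1 Nr2.
  have right_ext := @vanish_extend (x + k%:R * r) r r0 r1 Nr2.
  have [yx|yx] := leP y (x - k%:R * r).
    apply: left_ext; last by apply/andP; split; lra.
    by move=> z /andP[? ?]; apply: ih; apply/andP; split; lra.
  have [yx'|yx'] := leP y (x + 1 + k%:R * r); first by apply: ih; apply/andP; split; lra.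
  apply: right_ext; last by apply/andP; split; lra.
  by move=> z /andP[? ?]; apply: ih; apply/andP; split; lra.
move=> y; pose k := (Num.truncn (`|y - x| / r)).+1.
have : `|y - x| < k%:R * r by rewrite -ltr_pdivrMr//; exact: truncnS_gt.
rewrite ltr_norml => /andP[y1 y2]; apply: (ext k); apply/andP; split; lra.
Qed.

Hypothesis gordon : forall C X : R, 0 < C -> exists p, [/\ X <= p, 0 < p &
  forall v a b K, a <= b -> 0 < K -> lip v K -> supp_in v a b ->
  - p <= a -> b <= p -> b - a <= 2 ->
  cmod (L v - L (fun x => v (x - p))) <= K * expR (- (C * p))].
Hypothesis u_vanish : forall e : R, 0 < e ->
  exists X : R, forall x, X <= `|x| -> cmod (u x) <= e.

Section one_period.
Variables (x0 p r h eps : R) (m : nat).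
Hypotheses (x00 : 0 <= x0) (ux0 : u x0 != 0) (p0 : 0 < p).
Hypotheses (r0 : 0 < r) (r2 : r <= 1 / 2) (Nr : 2 * N * r <= 1 / 2).
Hypotheses (mh : m%:R * h = p) (h0 : 0 < h) (hr : h <= r).
Hypotheses (xp : x0 + 1 <= p) (eps0 : 0 <= eps) (epsh : eps <= h ^+ 3) (p2 : 2 <= p).
Hypothesis close : forall v a b K, a <= b -> 0 < K -> lip v K -> supp_in v a b ->
  - p <= a -> b <= p -> b - a <= 2 ->
  cmod (L v - L (fun x => v (x - p))) <= K * eps.

Let kap := cmod (u x0).
Let q x := u (x + p) + u (x - p).
Let tau := q x0 / u x0.
Let g x := q x - tau * u x.
Let e1 : R := 4 * S * eps.

Let kap0 : 0 < kap.
Proof.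
rewrite lt_neqAle cmod_ge0 andbT eq_sym; apply: contra ux0 => /eqP k.
by apply/eqP/cmod_eq0.
Qed.

Let lip_shift t : lip (fun x => u (x + t)) S.
Proof.
move=> x y; apply: le_trans (lu _ _) _.
by rewrite (_ : x + t - (y + t) = x - y)//; ring.
Qed.

Let cg : ccontinuous g.
Proof.
apply: ccontinuousB; last exact: ccontinuousZ cu.
by apply: ccontinuousD; apply: lip_ccontinuous; exact: lip_shift.
Qed.

Let tau_le : cmod tau <= 2 * S / kap.
Proof.
rewrite /tau cmodM cmodV -/kap ler_wpM2r ?invr_ge0 ?cmod_ge0//.
have := cmodD (u (x0 + p)) (u (x0 - p)); have := uS (x0 + p); have := uS (x0 - p).
rewrite -/(q x0); lra.
Qed.

Let lip_g : lip g ((2 + 2 * S / kap) * S).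
Proof.
move=> x y.
rewrite (_ : g x - g y = (u (x + p) - u (y + p)) + (u (x - p) - u (y - p)) - tau * (u x - u y));
  last by rewrite /g /q; ring.
have k1 := lip_shift p x y; have k2 := lip_shift (- p) x y.
have k3 : cmod (tau * (u x - u y)) <= 2 * S / kap * (S * `|x - y|).
  by rewrite cmodM; apply: ler_pM; rewrite ?cmod_ge0.
have k4 := cmodB ((u (x + p) - u (y + p)) + (u (x - p) - u (y - p))) (tau * (u x - u y)).
have k5 := cmodD (u (x + p) - u (y + p)) (u (x - p) - u (y - p)).
rewrite (_ : (2 + 2 * S / kap) * S * `|x - y| = S * `|x - y| + S * `|x - y| + 2 * S / kap * (S * `|x - y|));
  last by ring.
lra.
Qed.

Let e10 : 0 <= e1. Proof. by have S1 := S0; rewrite /e1 !mulr_ge0//; exact: ltW. Qed.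

Let approx_sub f al be al' be' e : al <= al' -> be' <= be ->
  approx_sol f al be e -> approx_sol f al' be' e.
Proof.
move=> aa bb hf a b c ha ab bc hc ca; apply: hf => //; lra.
Qed.

Let sol_g : approx_sol g x0 p (2 * e1).
Proof.
have p1 := p0; have x1 := x00.
have s1 := approx_sub (_ : - p <= x0) (lexx p) (approx_sol_right close).
have s2 := approx_sub x00 (_ : p <= 2 * p) (approx_sol_left close).
have s3 := @approx_sol_self x0 p.
have c1 : ccontinuous (fun x => u (x + p)) by apply: lip_ccontinuous; exact: lip_shift.
have c2 : ccontinuous (fun x => u (x - p)) by apply: lip_ccontinuous; exact: lip_shift.
have {}s1 := s1 ltac:(lra); have {}s2 := s2 ltac:(lra).
have s12 := approx_sol_lin 1 c1 c2 s1 s2.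
have c12 : ccontinuous (fun x => 1 * u (x + p) + u (x - p)).
  by apply: ccontinuousD => //; exact: ccontinuousZ.
have := approx_sol_lin (- tau) cu c12 s3 s12.
rewrite mulr0 add0r (_ : cmod 1 = 1); last exact: Normc.normc1.
rewrite (_ : 1 * _ + _ = 2 * e1); last by rewrite /e1; ring.
by rewrite (_ : (fun _ => _) = g)//; apply/funext => x; rewrite /g /q; ring.
Qed.

(** The Wronskian of [u] and [u (. + p)] takes nearly the same value at
    [x0 - p] and at [x0]; its value at [x0 - p] is the Wronskian of [u (. - p)]
    and [u] at [x0]. Hence [u] and [q] have a small Wronskian at [x0], so they are
    almost proportional there, with ratio [tau]. *)
Let g_near : cmod (g (x0 + h)) <= (4 * N * S ^+ 2 + 8 * S ^+ 2) / kap * (p * h) * h.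
Proof.
have p1 := p0; have x1 := x00; have S1 := S0; have N2 := N0; have h1 := h0; have r1 := r0.
have hr' := hr; have r2' := r2; have xp' := xp; have p2' := p2.
pose al := x0 - p.
have s1 : approx_sol (fun x => u (x + p)) al p e1.
  by apply: approx_sub (approx_sol_right close); rewrite /al; lra.
have h11 : h <= 1 by lra.
have ptE : al + m.+1%:R * h <= p.
  by rewrite -natr1 mulrDl mul1r mh /al; lra.
have := wronskian uS lu (fun x => uS (x + p)) (lip_shift p) (@approx_sol_self al p) s1 h0 h11 ptE.
rewrite mul0r addr0 mul1r.
have -> : al + m%:R * h = x0 by rewrite mh /al; ring.
have -> : al + m.+1%:R * h = x0 + h by rewrite -natr1 mulrDl mul1r mh /al; ring.
have -> : al + p = x0 by rewrite /al; ring.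
have -> : al + h + p = x0 + h by rewrite /al; ring.
have -> : al = x0 - p by [].
have -> : x0 - p + h = x0 + h - p by ring.
move=> W.
have gE : u x0 * g (x0 + h) = u x0 * u (x0 + h + p) - u (x0 + h) * u (x0 + p)
   - (u (x0 - p) * u (x0 + h) - u (x0 + h - p) * u x0).
  by rewrite /g /tau /q; field.
rewrite -gE cmodM -/kap in W.
rewrite -(ler_pM2l kap0); apply: (le_trans W).
rewrite (_ : kap * _ = (4 * N * S ^+ 2 + 8 * S ^+ 2) * (p * h) * h); last first.
  by field; rewrite gt_eqF.
have mhE : m.+1%:R * h = p + h by rewrite -natr1 mulrDl mul1r mh.
rewrite mhE /e1.
have k1 : 2 * N * S ^+ 2 * (p + h + 1) * h ^+ 2 <= 2 * N * S ^+ 2 * (2 * p) * h ^+ 2.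
  apply: ler_wpM2r; first by rewrite exprn_ge0// ltW.
  apply: ler_wpM2l; last by lra.
  by rewrite mulr_ge0 ?exprn_ge0//; lra.
have k2 : 2 * S * m%:R * (4 * S * eps) <= 8 * S ^+ 2 * (p * h) * h.
  rewrite (_ : 8 * S ^+ 2 * (p * h) * h = 2 * S * m%:R * (4 * S * h ^+ 3)); last first.
    by rewrite -mh; ring.
  apply: ler_wpM2l; first by rewrite !mulr_ge0 ?ler0n//; lra.
  by apply: ler_wpM2l => //; lra.
rewrite (_ : (4 * N * S ^+ 2 + 8 * S ^+ 2) * (p * h) * h =
  2 * N * S ^+ 2 * (2 * p) * h ^+ 2 + 8 * S ^+ 2 * (p * h) * h); last by ring.
exact: lerD.
Qed.

(** The relation [q = tau * u] propagates, by Gronwall, from [x0] to [p - z],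
    where [q] is [u (2 * p - z) + u (- z)] and involves the value [u (- z)]. *)
Lemma one_period_estimate z (k : nat) : 0 <= z -> x0 + z + 1 <= p -> p <= k.+1%:R * r ->
  cmod (u (- z)) <= 8 ^+ k * (h * p) *
     ((2 + 2 * S / kap) * S + 16 * S + (4 * N * S ^+ 2 + 8 * S ^+ 2) / kap) +
  cmod (u (2 * p - z)) + 2 * S / kap * cmod (u (p - z)).
Proof.
move=> z0 zp pk.
have p1 := p0; have x1 := x00; have S1 := S0; have N2 := N0; have h1 := h0; have r1 := r0.
have hr' := hr; have r2' := r2; have xp' := xp; have p2' := p2; have eps1 := eps0.
set T := 2 * S / kap; set W := (4 * N * S ^+ 2 + 8 * S ^+ 2) / kap.
have T0 : 0 <= T by rewrite /T divr_ge0 ?cmod_ge0//; lra.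
have W0 : 0 <= W.
  rewrite /W divr_ge0 ?cmod_ge0//.
  by rewrite addr_ge0// !mulr_ge0 ?exprn_ge0//; lra.
have e20 : 0 <= 2 * e1 by rewrite mulr_ge0.
have gx0 : g x0 = 0 by rewrite /g /tau divfK ?subrr.
have ph0 : 0 <= W * (p * h) by rewrite mulr_ge0// mulr_ge0 ?ltW.
have xr : x0 + r <= p by lra.
have start := gronwall_start cg sol_g e20 r0 r2 Nr h0 hr xr ph0 lip_g gx0 g_near.
have pz0 : x0 <= p - z by lra.
have pzp : p - z <= p by lra.
have pzk : p - z <= x0 + k.+1%:R * r by lra.
have G := gronwall cg sol_g e20 r0 r2 Nr start pz0 pzp pzk.
have gz : cmod (g (p - z)) <= 8 ^+ k * (h * p * ((2 + T) * S + 16 * S + W)).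
  apply: (@le_trans _ _ (cmod (g (p - z)) + 2 * e1)); first by rewrite lerDl.
  apply: (le_trans G); apply: ler_wpM2l; first by rewrite exprn_ge0.
  have h00 := ltW h1; have hle1 : h <= 1 by lra.
  have h2 : h ^+ 2 <= h by rewrite expr2; apply: ler_piMl.
  have h3 : h ^+ 3 <= h ^+ 2 by rewrite exprS; apply: ler_piMl; rewrite ?exprn_ge0.
  have epsh' := epsh.
  have k1 : 2 * e1 <= 8 * S * h.
    rewrite /e1 mulrA mulrA (_ : 2 * 4 = 8); last by ring.
    by apply: ler_wpM2l; lra.
  have k2 : 2 * e1 / h <= 8 * S * h.
    rewrite ler_pdivrMr// /e1.
    have : 8 * S * eps <= 8 * S * h ^+ 2 by apply: ler_wpM2l; lra.
    by rewrite expr2; lra.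
  have k3 : ((2 + T) * S + 16 * S) * h <= ((2 + T) * S + 16 * S) * (h * p).
    apply: ler_wpM2l; last by apply: ler_peMr; lra.
    by apply: addr_ge0; apply: mulr_ge0; lra.
  rewrite -/T -/W in k1 k2 *.
  rewrite (_ : h * p * _ = ((2 + T) * S + 16 * S) * (h * p) + W * (p * h)); last by ring.
  lra.
rewrite (_ : u (- z) = g (p - z) - u (2 * p - z) + tau * u (p - z)); last first.
  rewrite /g /q (_ : p - z + p = 2 * p - z); last by ring.
  by rewrite (_ : p - z - p = - z); ring.
have a1 := cmodD (g (p - z) - u (2 * p - z)) (tau * u (p - z)).
have a2 := cmodB (g (p - z)) (u (2 * p - z)).
have a3 : cmod (tau * u (p - z)) <= T * cmod (u (p - z)).
  by rewrite cmodM ler_wpM2r ?cmod_ge0.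
rewrite mulrA in gz; lra.
Qed.

End one_period.

(** With [p] as large as desired, the values [u (2 * p - z)] and [u (p - z)]
    are arbitrarily small since [u] vanishes at infinity, [tau] stays bounded
    since [u x0] is fixed, and the error is exponentially small. *)
Lemma gordon_half_line (x0 : R) : 0 <= x0 -> u x0 != 0 -> forall z, 0 <= z -> u (- z) = 0.
Proof.
move=> x00 ux0 z z0; apply: cmod_le_eq0 => eta eta0.
have N2 := N0; have S1 := S0.
have kap0 : 0 < cmod (u x0).
  rewrite lt_neqAle cmod_ge0 andbT eq_sym; apply: contra ux0 => /eqP k.
  by apply/eqP/cmod_eq0.
set kap := cmod (u x0) in kap0.
pose r : R := (4 * N + 4)^-1.
have r0 : 0 < r by rewrite invr_gt0; lra.
have rE : (4 * N + 4) * r = 1 by rewrite mulfV// gt_eqF//; lra.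
have Nr0 : 0 <= N * r by rewrite mulr_ge0// ltW.
have r2 : r <= 1 / 2 by lra.
have Nr : 2 * N * r <= 1 / 2 by lra.
pose T : R := 2 * S / kap.
have T0 : 0 <= T by rewrite /T divr_ge0//; [lra|exact: ltW].
pose A : R := (2 + T) * S + 16 * S + (4 * N * S ^+ 2 + 8 * S ^+ 2) / kap.
have A0 : 0 <= A.
  rewrite /A addr_ge0//; first by rewrite addr_ge0// mulr_ge0//; lra.
  by rewrite divr_ge0 ?(ltW kap0)// addr_ge0// !mulr_ge0 ?exprn_ge0//; lra.
have eta3 : 0 < eta / 3 by lra.
have etaT : 0 < eta / 3 / (T + 1) by rewrite divr_gt0//; lra.
have [X1 hX1] := u_vanish eta3; have [X2 hX2] := u_vanish etaT.
(* The Gronwall factor is at most [expR (3 / r * p)]; the summand [2] leaves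
   a factor [expR (- 2 * p)], which beats the powers of [p]. *)
pose C1 : R := 3 / r + 2.
have r3 : 0 < 3 / r by apply: divr_gt0.
have C10 : 0 < C1 by rewrite /C1; lra.
(* Weight [4 * C1] makes the weak distance smaller than [h ^+ 3]. *)
have C40 : 0 < 4 * C1 by lra.
pose X : R := `|X1| + `|X2| + x0 + z + 2 + (A / (eta / 3)) + r^-1.
have [p [Xp p0 hp]] := gordon X C40.
have Ae0 : 0 <= A / (eta / 3) by rewrite divr_ge0// ltW.
have ri0 : 0 <= r^-1 by rewrite invr_ge0 ltW.
have a1 := normr_ge0 X1; have a2 := normr_ge0 X2.
have a3 := ler_norm X1; have a4 := ler_norm X2.
rewrite /X in Xp; have [p2 pz pX1 pX2] : [/\ 2 <= p, x0 + z + 1 <= p, X1 <= p - z & X2 <= p - z].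
  by split; lra.
have [pA pr] : A / (eta / 3) <= p /\ r^-1 <= p by split; lra.
have C12 : 2 <= C1 by rewrite /C1; lra.
have [m [h [mh h0 hr hE epsh]]] := exponential_mesh r0 p2 pr C12.
have xp : x0 + 1 <= p by lra.
pose k := Num.truncn (p / r).
have pr0 : 0 <= p / r by rewrite divr_ge0 ?ltW.
have /andP[k1 k2] := truncn_itv pr0.
have pk : p <= k.+1%:R * r by rewrite -ler_pdivrMr// ltW.
have := one_period_estimate x00 ux0 p0 r0 r2 Nr mh h0 hr xp (ltW (expR_gt0 _)) epsh p2 hp z0 pz pk.
rewrite -/kap -/T -/A => est; apply: (le_trans est).
have b1 : cmod (u (2 * p - z)) <= eta / 3.
  by apply: hX1; rewrite ger0_norm; lra.
have b2 : T * cmod (u (p - z)) <= eta / 3.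
  have c1 : cmod (u (p - z)) <= eta / 3 / (T + 1).
    by apply: hX2; rewrite ger0_norm; lra.
  apply: (@le_trans _ _ ((T + 1) * (eta / 3 / (T + 1)))).
    by apply: ler_pM; rewrite ?cmod_ge0//; lra.
  by rewrite mulrC divfK// gt_eqF//; lra.
have b3 : 8 ^+ k * (h * p) * A <= eta / 3.
  have hp00 : 0 <= h * p by apply: mulr_ge0; exact: ltW.
  have khp00 : 0 <= 8 ^+ k * (h * p) by apply: mulr_ge0 => //; exact: exprn_ge0.
  have s1 := exponential_gain r0 p0 h0 hE k1.
  have s2 : A <= p * (eta / 3) by rewrite -ler_pdivrMr.
  apply: (@le_trans _ _ (8 ^+ k * (h * p) * (p * (eta / 3)))).
    exact: ler_wpM2l.
  rewrite mulrA; apply: ler_piMl => //; exact: ltW.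
lra.
Qed.

(** The solution vanishes on one of the two half-lines, hence everywhere. *)
Lemma gordon_no_solution x : u x = 0.
Proof.
have [h|/existsNP[x0 /not_implyP[x00 ux0]]] := pselect (forall y, 0 <= y -> u y = 0).
  by apply: (@unique_continuation 0) => y /andP[y0 _]; exact: h.
have {}ux0 : u x0 != 0 by apply/eqP.
apply: (@unique_continuation (-1)) => y /andP[_ y0].
rewrite -[y]opprK; apply: (gordon_half_line x00 ux0); lra.
Qed.

End gordon_argument.

(** * Absence of eigenvalues *)

Theorem corollary5p5 (R : realType) (mu : localMeasure R)
    (mu_loc_unif : loc_unif mu)
    (mu_gordon : forall C : R, 0 < C -> weak_gordon C mu) :
  forall lambda : R[i], ~ schrodinger_eigenvalue mu lambda.
Proof.
move=> lambda [u [eig]]; apply; apply: aeW => x.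
have [u2 _ cu _] := eig.
have [N N0 bound] := nu_bound lambda mu_loc_unif.
have u_hat a b c := @three_point _ _ _ _ mu_loc_unif eig a b c.
have [S S0 [uS lu]] := global_bounds cu N0 bound u_hat u2.
apply: (gordon_no_solution N0 S0 uS lu _ bound u_hat).
- by move=> v w z a b; exact: nu_lin.
- by move=> C X C0; exact: (nu_gordon lambda X C0 (mu_gordon C C0)).
- by move=> e; exact: (vanish_at_infinity cu N0 bound u_hat u2).
Qed.
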